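(* Suppose that: (1) $f$, $g_i$, $i\in M$, and $F$ are twice continuously Fréchet differentiable on $\Omega$, $\phi$ is continuously differentiable on its effective domain, and $\phi'(0)>0$; (2) for some bounded set $V\subseteq\Omega$ there exists $a>0$ such that for all $x\in V$ one has $Q(x)[\lambda,\mu]\ge a(\|\lambda\|^2+|\mu|^2)$ for all $\lambda\in H$, $\mu\in\mathbb{R}^m$; (3) the functions $f$, $g_i$, $i\in M$, and $F$, as well as their first and second order Fréchet derivatives, are bounded on $V$. Then for all $K>0$ and $\gamma\in\mathbb{R}$, and any bounded set $\Lambda\subset H\times\mathbb{R}^m$ there exists $c_*>0$ such that for all $c\ge c_*$ and $(x,\lambda,\mu)\in(V\times\Lambda)\cap S_c(\gamma)$ the following inequality holds: $$\big\|\nabla\mathcal{L}(x,\lambda,\mu,c)\big\|\ge K\left(\|F(x)\|+\left|\max\left\{g(x),-\frac{p(x,\mu)}{c}\mu\right\}\right|\right).\qquad( * )$$ In particular, if assumptions (1)–(3) are satisfied for $V=\Omega_r(\gamma+\varepsilon)$ with some $r>0$, $\varepsilon>0$, and $\gamma\in\mathbb{R}$ (this set being bounded), then for all $K>0$ there exists $c_*>0$ such that inequality $( * )$ holds for all $c\ge c_*$ and $(x,\lambda,\mu)\in S_c(\gamma)$.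
   Context: Setting. $X$ and $H$ are real Hilbert spaces, $M=\{1,\dots,m\}$, and $f,g_i\colon X\to\mathbb{R}$ ($i\in M$), $F\colon X\to H$ are continuously Fréchet differentiable; $g=(g_1,\dots,g_m)$. Problem $(\mathcal{P})$: minimise $f(x)$ subject to $F(x)=0$, $g_i(x)\le 0$, $i\in M$. It is assumed that $(\mathcal{P})$ has a globally optimal solution. $|\cdot|$ is the Euclidean norm; $\max\{y,z\}$ of vectors is taken coordinatewise; $\nabla g(x)y\in\mathbb{R}^m$ is the vector with coordinates $\langle\nabla g_i(x),y\rangle$; $DF(x)[\cdot]\colon X\to H$ is the Fréchet derivative, $DF(x)^*$ its adjoint; $\mathrm{diag}(\cdot)$ is the diagonal matrix. Product spaces carry the Hilbert product norm. The function $\phi\colon[0,+\infty)\to[0,+\infty]$ is convex, non-decreasing, lower semicontinuous, $\phi(t)=0$ iff $t=0$, $\mathrm{dom}\,\phi\ne\{0\}$, and either $\mathrm{dom}\,\phi=[0,+\infty)$ and $\phi(t)\to+\infty$ as $t\to\infty$, or $\mathrm{dom}\,\phi=[0,\alpha)$ for some $\alpha>0$ and $\phi(t)\to+\infty$ as $t\to\alpha$. The function $\psi\colon[0,+\infty)^m\to\mathbb{R}$ is continuously differentiable and concave, $\psi(0)>0$, $0$ is a global maximum point of $\psi$, and $\frac{\partial\psi}{\partial y_i}(y)=0$ whenever $y\in[0,+\infty)^m$, $y_i=0$. Put $b(x)=\psi(\max\{g(x),0\})$, $p(x,\mu)=b(x)/(1+|\mu|^2)$, $\Omega=\{x\in X\mid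 b(x)>0,\ \phi(\|F(x)\|^2)<+\infty\}$, $L(x,\lambda,\mu)=f(x)+\langle\lambda,F(x)\rangle+\langle\mu,g(x)\rangle$ for $\lambda\in H$, $\mu\in\mathbb{R}^m$, and $$\eta(x,\lambda,\mu)=\tfrac12\big\|DF(x)[\nabla_xL(x,\lambda,\mu)]\big\|^2+\tfrac12\sum_{i=1}^m\big(\langle\nabla g_i(x),\nabla_xL(x,\lambda,\mu)\rangle+g_i(x)^2\mu_i\big)^2.$$ For $c>0$ the augmented Lagrangian is $$\mathcal{L}(x,\lambda,\mu,c)=f(x)+\langle\lambda,F(x)\rangle+\tfrac c2(1+\|\lambda\|^2)\phi(\|F(x)\|^2)+\langle\mu,q\rangle+\tfrac{c}{2p(x,\mu)}|q|^2+\eta(x,\lambda,\mu),\quad q=\max\{g(x),-\tfrac1c p(x,\mu)\mu\},$$ if $x\in\Omega$, and $\mathcal{L}(x,\lambda,\mu,c)=+\infty$ otherwise. $\nabla\mathcal{L}(x,\lambda,\mu,c)$ denotes the gradient of $(x,\lambda,\mu)\mapsto\mathcal{L}(x,\lambda,\mu,c)$ at a point of $\Omega\times H\times\mathbb{R}^m$ (under assumption (1) this function is continuously Fréchet differentiable there). $S_c(\gamma)=\{(x,\lambda,\mu)\in X\times H\times\mathbb{R}^m\mid\mathcal{L}(x,\lambda,\mu,c)\le\gamma\}$, and $\Omega_c(\gamma)=\{x\in\Omega\mid f(x)+c(\|F(x)\|^2+|\max\{g(x),0\}|^2)\le\gamma\}$. Finally, $$Q(x)[\lambda,\mu]=\tfrac12\Big\|DF(x)\Big[DF(x)^*[\lambda]+\sum_{i=1}^m\mu_i\nabla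 g_i(x)\Big]\Big\|^2+\tfrac12\Big|\nabla g(x)\Big(DF(x)^*[\lambda]+\sum_{i=1}^m\mu_i\nabla g_i(x)\Big)+\mathrm{diag}(g_i(x)^2)\mu\Big|^2.$$ *)

(* Defs.v *)
From HB Require Import structures.
From mathcomp Require Export all_boot all_order all_algebra.
From mathcomp Require Export all_classical all_reals all_analysis.

Set Implicit Arguments.
Unset Strict Implicit.
Unset Printing Implicit Defensive.

Import Order.TTheory GRing.Theory Num.Theory.
Import numFieldNormedType.Exports.

Local Open Scope classical_set_scope.
Local Open Scope ring_scope.

HB.mixin Record CompleteNormedModule_isHilbert (R : realType) X
    of CompleteNormedModule R X := {
  inner : X -> X -> R;
  innerC : forall x y, inner x y = inner y x;
  innerDl : forall x y z, inner (x + y) z = inner x z + inner y z;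
  innerZl : forall a x y, inner (a *: x) y = a * inner x y;
  inner_normE : forall x, inner x x = `|x| ^+ 2
}.

#[short(type="hilbertType")]
HB.structure Definition Hilbert (R : realType) :=
  {X of CompleteNormedModule R X & CompleteNormedModule_isHilbert R X}.

(* Vectors of R^m are rows: the library norm on 'rV[R]_m is the sup norm, so
   the Euclidean one is introduced separately (the topology is the same). *)
Definition dotr (R : realType) (m : nat) (u v : 'rV[R]_m) : R :=
  \sum_(i < m) u 0 i * v 0 i.

Definition enorm (R : realType) (m : nat) (u : 'rV[R]_m) : R :=
  Num.sqrt (dotr u u).

(* Inner product of the Hilbert product X * H * R^m. The library norm of this
   product is the max norm; it is equivalent to the Hilbert one, hence it yields
   the same bounded sets and the same Frechet derivatives. *)
Definition prod_inner (R : realType) (X H : hilbertType R) (m : nat)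
    (u v : X * H * 'rV[R]_m) : R :=
  inner u.1.1 v.1.1 + inner u.1.2 v.1.2 + dotr u.2 v.2.

(* The vector representing the linear form l in the inner product ip; by the
   Riesz theorem it exists and is unique when l is continuous and ip is the
   inner product of a Hilbert space. The default 0 is never used then. *)
Definition riesz (R : realType) (V : lmodType R) (ip : V -> V -> R)
    (l : V -> R) : V :=
  xget 0 [set z | forall u, ip z u = l u].

Definition grad (R : realType) (X : hilbertType R) (h : X -> R) (x : X) : X :=
  riesz inner ('d h x).

Definition adjoint (R : realType) (X H : hilbertType R) (A : X -> H)
    (l : H) : X :=
  riesz inner (fun u => inner l (A u)).

(* Continuous Frechet differentiability on an open set U: y |-> 'd f y is
   continuous for the operator norm. *)
Definition C1_on (R : realType) (V W : normedModType R) (U : set V)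
    (f : V -> W) : Prop :=
  forall x, U x -> differentiable f x /\
    forall e : R, 0 < e ->
      \forall y \near x, forall h, `|'d f y h - 'd f x h| <= e * `|h|.

(* B is the Frechet derivative at x of the operator-valued map y |-> 'd f y:
   B k h is the value at h of the operator obtained in the direction k. The
   last conjunct says that the operator norm of 'd f y - 'd f x - B (y - x) is
   o(|y - x|). *)
Definition is_diff2 (R : realType) (V W : normedModType R) (f : V -> W)
    (x : V) (B : V -> V -> W) : Prop :=
  [/\ forall k, linear (B k),
      forall h, linear (B^~ h),
      exists C : R, forall k h, `|B k h| <= C * `|k| * `|h| &
      forall e : R, 0 < e -> \forall y \near x, forall h,
        `|'d f y h - 'd f x h - B (y - x) h| <= e * `|y - x| * `|h|].

Definition diff2 (R : realType) (V W : normedModType R) (f : V -> W)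
    (x : V) : V -> V -> W :=
  xget (fun _ _ => 0) [set B | is_diff2 f x B].

Definition C2_on (R : realType) (V W : normedModType R) (U : set V)
    (f : V -> W) : Prop :=
  C1_on U f /\
  forall x, U x -> is_diff2 f x (diff2 f x) /\
    forall e : R, 0 < e -> \forall y \near x, forall k h,
      `|diff2 f y k h - diff2 f x k h| <= e * `|k| * `|h|.

(* f and its first two Frechet derivatives (in operator norm) are bounded. *)
Definition bounded_C2 (R : realType) (V W : normedModType R) (A : set V)
    (f : V -> W) : Prop :=
  [/\ [bounded f x | x in A],
      exists C : R, forall x, A x -> forall h, `|'d f x h| <= C * `|h| &
      exists C : R, forall x, A x -> forall k h,
        `|diff2 f x k h| <= C * `|k| * `|h|].

(* D is a continuous derivative of f relative to a set A that need not be open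
   (one-sided at boundary points). *)
Definition C1_within (R : realType) (V W : normedModType R) (A : set V)
    (f : V -> W) (D : V -> V -> W) : Prop :=
  forall x, A x ->
    [/\ linear (D x), continuous (D x),
        forall e : R, 0 < e -> \forall y \near within A (nbhs x),
          `|f y - f x - D x (y - x)| <= e * `|y - x| &
        forall e : R, 0 < e -> \forall y \near within A (nbhs x), forall h,
          `|D y h - D x h| <= e * `|h|].

(* phi is only meaningful on [0, +oo[; nothing is assumed about phi t, t < 0. *)
Definition edom (R : realType) (phi : R -> \bar R) : set R :=
  [set t | 0 <= t /\ (phi t < +oo)%E].

Record phi_assumptions (R : realType) (phi : R -> \bar R) : Prop := {
  phi_ge0 : forall t : R, 0 <= t -> (0 <= phi t)%E;
  phi_convex : forall s t a : R, 0 <= s -> 0 <= t -> 0 <= a <= 1 ->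
    (phi (a * s + (1 - a) * t)%R <= a%:E * phi s + (1 - a)%R%:E * phi t)%E;
  phi_nondecreasing : forall s t : R, 0 <= s -> s <= t -> (phi s <= phi t)%E;
  phi_lsc : lower_semicontinuous (phi : subspace `[0, +oo[ -> \bar R);
  phi_eq0 : forall t : R, 0 <= t -> (phi t = 0%E <-> t = 0);
  phi_edom_neq0 : edom phi <> [set 0];
  phi_barrier :
    (edom phi = `[0, +oo[%classic /\ phi t @[t --> +oo%R] --> +oo%E) \/
    (exists alpha : R, [/\ 0 < alpha, edom phi = `[0, alpha[%classic &
                       phi t @[t --> alpha^'-] --> +oo%E])
}.

Definition phi_C1 (R : realType) (phi : R -> \bar R) : Prop :=
  exists D, C1_within (edom phi) (fun t => fine (phi t)) D /\ 0 < D 0 1.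

Definition orthant (R : realType) (m : nat) : set 'rV[R]_m :=
  [set y | forall i, 0 <= y 0 i].

(* psi is only meaningful on the orthant. *)
Record psi_assumptions (R : realType) (m : nat) (psi : 'rV[R]_m -> R) : Prop := {
  psi_C1 : exists D, C1_within (@orthant R m) psi D /\
    forall (y : 'rV[R]_m) i, orthant y -> y 0 i = 0 -> D y (delta_mx 0 i) = 0;
  psi_concave : forall (y z : 'rV[R]_m) (a : R), orthant y -> orthant z -> 0 <= a <= 1 ->
    a * psi y + (1 - a) * psi z <= psi (a *: y + (1 - a) *: z);
  psi0_gt0 : 0 < psi 0;
  psi_max : forall y : 'rV[R]_m, orthant y -> psi y <= psi 0
}.

Section AugmentedLagrangian.
Context (R : realType) (X H : hilbertType R) (m : nat).
Context (f : X -> R) (F : X -> H) (g : 'I_m -> X -> R).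
Context (phi : R -> \bar R) (psi : 'rV[R]_m -> R).

Definition feasible : set X :=
  [set x | F x = 0 /\ forall i, g i x <= 0].

Definition has_global_solution : Prop :=
  exists2 x, feasible x & forall y, feasible y -> f x <= f y.

Definition gpos (x : X) : 'rV[R]_m := \row_i Num.max (g i x) 0.

Definition bfun (x : X) : R := psi (gpos x).

Definition pfun (x : X) (mu : 'rV[R]_m) : R := bfun x / (1 + enorm mu ^+ 2).

Definition Omega : set X :=
  [set x | 0 < bfun x /\ (phi (`|F x| ^+ 2)%R < +oo)%E].

Definition lagr (x : X) (lam : H) (mu : 'rV[R]_m) : R :=
  f x + inner lam (F x) + dotr mu (\row_i g i x).

Definition grad_lagr (x : X) (lam : H) (mu : 'rV[R]_m) : X :=
  grad (fun y => lagr y lam mu) x.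

Definition eta_pen (x : X) (lam : H) (mu : 'rV[R]_m) : R :=
  2^-1 * `|'d F x (grad_lagr x lam mu)| ^+ 2 +
  2^-1 * \sum_(i < m)
    (inner (grad (g i) x) (grad_lagr x lam mu) + g i x ^+ 2 * mu 0 i) ^+ 2.

Definition qfun (x : X) (mu : 'rV[R]_m) (c : R) : 'rV[R]_m :=
  \row_i Num.max (g i x) (- (pfun x mu / c) * mu 0 i).

Definition auglagr (x : X) (lam : H) (mu : 'rV[R]_m) (c : R) : \bar R :=
  if `[< Omega x >] then
    (f x + inner lam (F x)
     + c / 2 * (1 + `|lam| ^+ 2) * fine (phi (`|F x| ^+ 2))
     + dotr mu (qfun x mu c)
     + c / (2 * pfun x mu) * enorm (qfun x mu c) ^+ 2
     + eta_pen x lam mu)%:E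
  else +oo%E.

(* Gradient of the augmented Lagrangian jointly in (x, lambda, mu), taken on
   the open set Omega * H * R^m, where the function is finite. *)
Definition grad_auglagr (c : R) (w : X * H * 'rV[R]_m) : X * H * 'rV[R]_m :=
  riesz (@prod_inner R X H m)
    ('d (fun v : X * H * 'rV[R]_m => fine (auglagr v.1.1 v.1.2 v.2 c)) w).

Definition norm_grad_auglagr (c : R) (w : X * H * 'rV[R]_m) : R :=
  Num.sqrt (prod_inner (grad_auglagr c w) (grad_auglagr c w)).

Definition sublevel (c gamma : R) : set (X * H * 'rV[R]_m) :=
  [set w | (auglagr w.1.1 w.1.2 w.2 c <= gamma%:E)%E].

Definition Omega_lev (c gamma : R) : set X :=
  [set x | Omega x /\
     f x + c * (`|F x| ^+ 2 + enorm (gpos x) ^+ 2) <= gamma].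

Definition Qdir (x : X) (lam : H) (mu : 'rV[R]_m) : X :=
  adjoint ('d F x) lam + \sum_(i < m) mu 0 i *: grad (g i) x.

Definition Qfun (x : X) (lam : H) (mu : 'rV[R]_m) : R :=
  2^-1 * `|'d F x (Qdir x lam mu)| ^+ 2 +
  2^-1 * enorm ((\row_i inner (grad (g i) x) (Qdir x lam mu))
                + mu *m diag_mx (\row_i (g i x ^+ 2))) ^+ 2.

Definition Q_coercive_on (V : set X) : Prop :=
  exists2 a : R, 0 < a & forall x, V x -> forall lam mu,
    a * (`|lam| ^+ 2 + enorm mu ^+ 2) <= Qfun x lam mu.

Definition data_bounded_on (V : set X) : Prop :=
  [/\ bounded_C2 V f, forall i, bounded_C2 V (g i) & bounded_C2 V F].

Definition grad_lower_bound (K c : R) (w : X * H * 'rV[R]_m) : Prop :=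
  K * (`|F w.1.1| + enorm (qfun w.1.1 w.2 c)) <= norm_grad_auglagr c w.

End AugmentedLagrangian.

(* Main.v *)
(* Riesz representation turns derivatives into gradients, so that the augmented
   Lagrangian L(.,.,.,c) is Frechet differentiable on Omega * H * R^m with an
   explicit derivative. Write (u, v) for the pair whose half squared norm is
   eta, T := |grad L| + |F| + |q| + c (|F|^2 + |q|^2), and w(l, s) :=
   DF^* l + sum_i s_i grad g_i. Coercivity of Q and boundedness of the data give
   |w(l, s)|^2 + sum_i g_i^2 s_i^2 >= a1 (|l|^2 + |s|^2).
   Testing grad L against (0, u, v) bounds |u| + |v| by C T; testing it against
   (w(z), 0, 0) with z := ((1 + |lambda|^2) phi' F, q / p), and using the
   complementarity (mu_i + c q_i / p)(q_i - g_i) = 0, bounds c (|F| + |q|) by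
   C T. On a sublevel set |F|^2 + |q|^2 = O(1/c), so for large c the terms of T
   other than |grad L| are absorbed by c (|F| + |q|). *)
From HB Require Import structures.
Require Import Defs.
From mathcomp Require Import all_boot all_order all_algebra.
From mathcomp Require Import all_classical all_reals all_analysis.
From mathcomp Require Import ring lra.

Set Implicit Arguments.
Unset Strict Implicit.
Unset Printing Implicit Defensive.

Import Order.TTheory GRing.Theory Num.Theory.
Import numFieldNormedType.Exports.

Local Open Scope classical_set_scope.
Local Open Scope ring_scope.

(** The direction w(z) is forced by the shape of the x-derivative: it equals grad L + c w(z), minus
    a term quadratic in q, plus the derivative of eta. Pairing grad L with w(z) returns the
    residuals u, v, up to z_i g_i^2 mu_i; hence the residuals are estimated first. The obstacle is
    that coercivity loses c g_i^2 z_i^2, which on an inactive constraint is not small compared with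
    c |z|^2. Added to z_i g_i^2 mu_i it forms z_i g_i^2 (mu_i + c z_i), where complementarity trades
    g_i^2 for q_i^2. Constants must not depend on the point, so all data enter through one bound
    [M]; p and phi' are kept away from 0 by first forcing F and q close to 0. Neither max spoils
    differentiability: the penalty is rewritten with a squared positive part, and the partial
    derivatives of psi vanish where max(g_i, 0) bends. For a whole sublevel set two facts are added:
    eta dominates half of Q up to a constant, which bounds the multipliers, and the growth estimate,
    with eps paying for its O(1/c) remainder, puts x into the given set. *)

Section InnerProducts.
Context (R : realType).

(** * Linear maps, Cauchy-Schwarz and the Riesz theorem *)

Section LinearFunction.
Context (V W : lmodType R) (l : V -> W) (llin : linear l).

Lemma islinD u v : l (u + v) = l u + l v.
Proof. by have := llin 1 u v; rewrite !scale1r. Qed.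

Lemma islin0 : l 0 = 0.
Proof. by apply: (addrI (l 0)); rewrite -islinD !addr0. Qed.

Lemma islinZ a u : l (a *: u) = a *: l u.
Proof. by rewrite -[a *: u]addr0 llin islin0 addr0. Qed.

Lemma islinN u : l (- u) = - l u.
Proof. by rewrite -scaleN1r islinZ scaleN1r. Qed.

Lemma islinB u v : l (u - v) = l u - l v.
Proof. by rewrite islinD islinN. Qed.

End LinearFunction.

(** The discriminant criterion, degenerate leading coefficient included. It serves Cauchy-Schwarz
    and the estimate on near-minimizers in the Riesz theorem. *)
Lemma quadratic_ge0_discr (a b e : R) : 0 <= a -> 0 <= e ->
  (forall t : R, 0 <= t ^+ 2 * a + 2 * t * b + e) -> b ^+ 2 <= a * e.
Proof.
move=> a0 e0 H; have [a_eq0|a_neq0] := eqVneq a 0.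
  have [->|b0] := eqVneq b 0; first by rewrite a_eq0 mul0r expr0n.
  (* With a = 0 the expression is affine in t; this t gives it the value -1. *)
  have := H (- (e + 1) / (2 * b)).
  rewrite a_eq0 mulr0 add0r.
  have -> : 2 * (- (e + 1) / (2 * b)) * b + e = -1 by field.
  by rewrite ler0N1.
have a_gt0 : 0 < a by rewrite lt_neqAle eq_sym a_neq0.
have := H (- b / a).
have -> : (- b / a) ^+ 2 * a + 2 * (- b / a) * b + e = (a * e - b ^+ 2) / a.
  by field.
by rewrite pmulr_lge0 ?invr_gt0// subr_ge0.
Qed.

(** Only a symmetric positive semidefinite form is asked for, so one proof covers [inner], [dotr]
    and [prod_inner]; the last two live on spaces normed by a maximum. *)
Lemma cauchy_schwarz (V : lmodType R) (ip : V -> V -> R) :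
  (forall x y, ip x y = ip y x) ->
  (forall x y z, ip (x + y) z = ip x z + ip y z) ->
  (forall a x y, ip (a *: x) y = a * ip x y) ->
  (forall x, 0 <= ip x x) ->
  forall x y, `|ip x y| <= Num.sqrt (ip x x) * Num.sqrt (ip y y).
Proof.
move=> ipC ipD ipZ ip0 x y.
rewrite -(@ler_pXn2r _ 2) ?nnegrE// ?mulr_ge0 ?sqrtr_ge0//.
rewrite real_normK ?num_real// exprMn !sqr_sqrtr//.
apply: quadratic_ge0_discr => // t.
suff -> : t ^+ 2 * ip x x + 2 * t * ip x y + ip y y = ip (t *: x + y) (t *: x + y)
  by [].
have ipDr u v w : ip u (v + w) = ip u v + ip u w by rewrite ipC ipD !(ipC u).
have ipZr b u v : ip u (b *: v) = b * ip u v by rewrite ipC ipZ ipC.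
by rewrite ipD ipZ !ipDr !ipZr (ipC y x); ring.
Qed.

Section Hilbert.
Context (X : hilbertType R).
Implicit Types x y z : X.

Lemma innerDr x y z : inner x (y + z) = inner x y + inner x z.
Proof. by rewrite innerC innerDl !(innerC x). Qed.

Lemma innerZr (a : R) x y : inner x (a *: y) = a * inner x y.
Proof. by rewrite innerC innerZl innerC. Qed.

Lemma innerNl x y : inner (- x) y = - inner x y.
Proof. by rewrite -scaleN1r innerZl mulN1r. Qed.

Lemma innerBl x y z : inner (x - y) z = inner x z - inner y z.
Proof. by rewrite innerDl innerNl. Qed.

Lemma innerNr x y : inner x (- y) = - inner x y.
Proof. by rewrite innerC innerNl innerC. Qed.

Lemma innerBr x y z : inner x (y - z) = inner x y - inner x z.
Proof. by rewrite innerDr innerNr. Qed.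

Lemma inner0l x : inner 0 x = 0 :> R.
Proof. by rewrite -(scale0r 0) innerZl mul0r. Qed.

Lemma inner0r x : inner x 0 = 0 :> R.
Proof. by rewrite innerC inner0l. Qed.

Lemma inner_suml (I : Type) (r : seq I) (P : pred I) (h : I -> X) y :
  inner (\sum_(i <- r | P i) h i) y = \sum_(i <- r | P i) inner (h i) y.
Proof.
by elim/big_rec2: _ => [|i a b _ <-]; rewrite ?inner0l// innerDl.
Qed.

Lemma inner_ge0 x : 0 <= inner x x.
Proof. by rewrite inner_normE exprn_ge0. Qed.

Lemma ler_inner x y : `|inner x y| <= `|x| * `|y|.
Proof.
have := cauchy_schwarz (@innerC R X) (@innerDl R X) (@innerZl R X) inner_ge0 x y.
by rewrite !inner_normE !sqrtr_sqr !normr_id.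
Qed.

Lemma inner_inj x y : (forall u, inner x u = inner y u) -> x = y.
Proof.
move=> xy; apply/eqP; rewrite -subr_eq0 -normr_eq0 -sqrf_eq0 -inner_normE.
by rewrite innerBl xy subrr.
Qed.

(* A minimizing sequence of |u|^2 - 2 l(u) is Cauchy by the parallelogram law. *)
Theorem riesz_representation (l : X -> R) (C : R) :
  linear l -> (forall u, `|l u| <= C * `|u|) ->
  exists z, forall u, inner z u = l u.
Proof.
move=> llin lC.
have lD := islinD llin; have lZ : forall a u, l (a *: u) = a * l u := islinZ llin.
pose J (u : X) : R := `|u| ^+ 2 - 2 * l u.
have JN2 u : - C ^+ 2 <= J u.
  have := sqr_ge0 (`|u| - C); rewrite /J.
  have := lC u; rewrite ler_norml => /andP[_ ?] ?; nra.
have hJ : has_inf (range J).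
  split; first by exists (J 0), 0.
  by exists (- C ^+ 2) => _ [u _ <-].
have Jinf u : inf (range J) <= J u by apply: ge_inf; [case: hJ | exists u].
have /choice[s sP] : forall n : nat, exists u, J u < inf (range J) + n.+1%:R^-1.
  move=> n; have n0 : 0 < n.+1%:R^-1 :> R by rewrite invr_gt0.
  by have [_ [u _ <-] uP] := inf_adherent n0 hJ; exists u.
have JE u v : J (u + v) = J u + `|v| ^+ 2 + 2 * (inner u v - l v).
  by rewrite /J -!inner_normE innerDl !innerDr lD (innerC v u); ring.
(* Moving from [s n] by t u cannot bring J below its infimum, so a quadratic in t with constant term
   1/(n+1) is nonnegative; its discriminant gives the bound. *)
have near_rep n u : (inner (s n) u - l u) ^+ 2 <= `|u| ^+ 2 * n.+1%:R^-1.
  apply: quadratic_ge0_discr => [||t]; rewrite ?exprn_ge0// ?invr_ge0//.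
  have := Jinf (s n + t *: u); have := sP n.
  rewrite JE normrZ exprMn real_normK ?num_real// innerZr lZ => h1 h2.
  by move: (J _) (inf _) (n.+1%:R^-1) h1 h2 => ? ? ? ? ?; lra.
(* J at the midpoint is at least the infimum, while [s n] and [s k] are within 1/(n+1) and 1/(k+1)
   of it. *)
have sdist n k : `|s n - s k| ^+ 2 <= 2 * (n.+1%:R^-1 + k.+1%:R^-1).
  have := Jinf (2^-1 *: (s n + s k)); have := sP n; have := sP k.
  rewrite /J lZ lD -!inner_normE innerZl innerZr !innerDl !innerDr.
  rewrite innerNl innerNr innerNl innerNr (innerC (s k) (s n)) => h1 h2 h3.
  move: (inf _) (n.+1%:R^-1) (k.+1%:R^-1) h1 h2 h3 => ? ? ? ? ? ?; lra.
have scauchy : cauchy (s @ \oo).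
  apply: cauchy_exP => e e0; pose d := (e ^+ 2 / 8)%R.
  have d0 : 0 < d by rewrite divr_gt0// exprn_gt0.
  pose N := Num.truncn d^-1; exists (s N); exists N => // n /= Nn.
  rewrite -ball_normE /ball_/= -(@ltr_pXn2r _ 2) ?nnegrE ?(ltW e0)//.
  have Nd : N.+1%:R^-1 < d.
    by rewrite -ltf_pV2 ?posrE ?invr_gt0// invrK truncnS_gt.
  have nd : n.+1%:R^-1 < d.
    by apply: le_lt_trans Nd; rewrite lef_pV2 ?posrE// ler_nat.
  apply: le_lt_trans (sdist _ _) _.
  by move: (n.+1%:R^-1) (N.+1%:R^-1) nd Nd d0 => ? ?; rewrite /d => ? ? ?; lra.
have /cvg_ex[z sz] : cvg (s @ \oo).
  exact: cauchy_cvg.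
exists z => u; apply/eqP; rewrite -subr_eq0 -normr_le0.
apply/ler_addgt0Pl => e e0; rewrite addr0.
have u1 : 0 < `|u| + 1 by rewrite ltr_wpDl.
have [d d0 dE] : exists2 d : R, 0 < d & e = d * (2 * (`|u| + 1)).
  exists (e / (2 * (`|u| + 1))); first by rewrite divr_gt0// mulr_gt0.
  by rewrite divfK// gt_eqF// mulr_gt0.
near \oo => n.
have zn : `|z - s n| < d.
  by near: n; move/cvgrPdist_lt: sz; apply.
have nd : n.+1%:R^-1 < d ^+ 2.
  near: n; exists (Num.truncn (d ^+ 2)^-1) => // n /= Nn.
  rewrite -ltf_pV2 ?posrE ?invr_gt0 ?exprn_gt0// invrK.
  by apply: lt_le_trans (truncnS_gt _) _; rewrite ler_nat ltnS.
have -> : inner z u - l u = inner (z - s n) u + (inner (s n) u - l u).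
  by rewrite innerBl; ring.
apply: le_trans (ler_normD _ _) _.
have h1 : `|inner (z - s n) u| <= d * `|u|.
  by apply: le_trans (ler_inner _ _) _; rewrite ler_wpM2r// ltW.
have h2 : `|inner (s n) u - l u| <= d * `|u|.
  rewrite -(@ler_pXn2r _ 2) ?nnegrE ?mulr_ge0 ?(ltW d0)// real_normK ?num_real//.
  apply: le_trans (near_rep n u) _.
  by rewrite exprMn mulrC ler_wpM2r ?sqr_ge0// ltW.
apply: le_trans (lerD h1 h2) _.
have := d0; have := normr_ge0 u; rewrite dE; nra.
Unshelve. all: by end_near. Qed.

End Hilbert.
End InnerProducts.

(** * Gradients and adjoints as Riesz vectors *)

Section Riesz.
Context (R : realType) (X : hilbertType R).

Lemma rieszP (l : X -> R) (C : R) :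
  linear l -> (forall u, `|l u| <= C * `|u|) ->
  forall u, inner (riesz inner l) u = l u.
Proof.
move=> llin lC.
exact: (xgetPex (0 : X) (riesz_representation llin lC)).
Qed.

Lemma rieszE (l : X -> R) z : (forall u, inner z u = l u) -> riesz inner l = z.
Proof.
move=> zl; apply: inner_inj => u; rewrite zl.
exact: (xgetPex (0 : X) (P := [set z | forall u, inner z u = l u])
  (ex_intro _ z zl)).
Qed.

(** Evaluating l at its own Riesz vector z gives |z|^2 <= C |z|. Operator-norm estimates thus pass
    to gradients and adjoints without loss. *)
Lemma norm_riesz (l : X -> R) (C : R) : 0 <= C ->
  linear l -> (forall u, `|l u| <= C * `|u|) -> `|riesz inner l| <= C.
Proof.
move=> C0 llin lC; have [->|z0] := eqVneq (riesz inner l) 0.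
  by rewrite normr0.
have z_gt0 : 0 < `|riesz inner l| by rewrite normr_gt0.
rewrite -(ler_pM2r z_gt0) -expr2 -inner_normE (rieszP llin lC).
exact: le_trans (ler_norm _) (lC _).
Qed.

Lemma linear_diff_bounded (V W : normedModType R) (h : V -> W) x :
  differentiable h x -> exists2 C : R, 0 < C & forall u, `|'d h x u| <= C * `|u|.
Proof.
by move=> hx; have [C C0 CP] := linear_lipschitz (diff_continuous hx); exists C.
Qed.

Lemma gradP (h : X -> R) x : differentiable h x ->
  forall u, inner (grad h x) u = 'd h x u.
Proof.
move=> /linear_diff_bounded[C _ CP]; apply: rieszP CP.
by move=> a u v; rewrite linearP.
Qed.

Lemma norm_grad (h : X -> R) x (C : R) : 0 <= C -> differentiable h x ->
  (forall u, `|'d h x u| <= C * `|u|) -> `|grad h x| <= C.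
Proof.
by move=> C0 hx; apply: norm_riesz => // a u v; rewrite linearP.
Qed.

Section Adjoint.
Context (H : hilbertType R) (A : X -> H) (C : R).
Context (Alin : linear A) (leA : forall u, `|A u| <= C * `|u|).

Let inner_A_linear l : linear (fun u => inner l (A u)).
Proof. by move=> a u v; rewrite Alin innerDr innerZr. Qed.

Let inner_A_bounded l u : `|inner l (A u)| <= C * `|l| * `|u|.
Proof.
apply: le_trans (ler_inner _ _) _.
by rewrite mulrAC mulrC ler_wpM2r.
Qed.

Lemma inner_adjoint l u : inner (adjoint A l) u = inner l (A u).
Proof. exact: (rieszP (inner_A_linear l) (inner_A_bounded l)). Qed.

Lemma adjoint_linear : linear (adjoint A).
Proof.
by move=> a u v; apply: inner_inj => w; rewrite innerDl innerZl !inner_adjoint innerDl innerZl.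
Qed.

Lemma norm_adjoint l : 0 <= C -> `|adjoint A l| <= C * `|l|.
Proof.
by move=> C0; apply: norm_riesz (inner_A_linear l) (inner_A_bounded l); rewrite mulr_ge0.
Qed.

End Adjoint.
End Riesz.

(** * Euclidean norm against maximum norm on R^m *)

Section Euclidean.
Context (R : realType) (m : nat).
Implicit Types u v w : 'rV[R]_m.

Lemma dotrC u v : dotr u v = dotr v u.
Proof. by apply: eq_bigr => i _; rewrite mulrC. Qed.

Lemma dotrDl u v w : dotr (u + v) w = dotr u w + dotr v w.
Proof. by rewrite /dotr -big_split; apply: eq_bigr => i _; rewrite mxE mulrDl. Qed.

Lemma dotrZl (a : R) u v : dotr (a *: u) v = a * dotr u v.
Proof. by rewrite /dotr mulr_sumr; apply: eq_bigr => i _; rewrite mxE mulrA. Qed.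

Lemma dotr_ge0 u : 0 <= dotr u u.
Proof. by apply: sumr_ge0 => i _; rewrite -expr2 sqr_ge0. Qed.

Lemma enorm_ge0 u : 0 <= enorm u.
Proof. exact: sqrtr_ge0. Qed.

Lemma enormE u : enorm u ^+ 2 = \sum_i u 0 i ^+ 2.
Proof.
by rewrite sqr_sqrtr ?dotr_ge0//; apply: eq_bigr => i _; rewrite expr2.
Qed.

Lemma enorm_sqr u : enorm u ^+ 2 = dotr u u.
Proof. by rewrite sqr_sqrtr ?dotr_ge0. Qed.

Lemma ler_dotr u v : `|dotr u v| <= enorm u * enorm v.
Proof. exact: cauchy_schwarz dotrC dotrDl dotrZl dotr_ge0 u v. Qed.

Lemma coord_le_enorm u i : `|u 0 i| <= enorm u.
Proof.
rewrite -(@ler_pXn2r _ 2) ?nnegrE ?enorm_ge0// real_normK ?num_real// enormE.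
by rewrite (bigD1 i)//= lerDl sumr_ge0// => j _; rewrite sqr_ge0.
Qed.

Lemma coord_le_norm u i : `|u 0 i| <= `|u|.
Proof.
rewrite [leRHS]/Num.Def.normr /= mx_normrE; apply/bigmax_geP; right => /=.
by exists (0, i).
Qed.

Lemma enorm_le_norm u : enorm u <= m%:R * `|u|.
Proof.
rewrite -(@ler_pXn2r _ 2) ?nnegrE ?enorm_ge0 ?mulr_ge0// enormE exprMn.
apply: (@le_trans _ _ (\sum_(i < m) `|u| ^+ 2)).
  apply: ler_sum => i _; rewrite -real_normK ?num_real//.
  by rewrite lerXn2r ?nnegrE// coord_le_norm.
rewrite sumr_const card_ord -[leLHS]mulr_natl; apply: ler_wpM2r.
  exact: sqr_ge0.
by rewrite -natrX ler_nat; case: (m) => // n; rewrite leq_pmulr.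
Qed.

Lemma norm_le_enorm u : `|u| <= enorm u.
Proof.
rewrite [leLHS]/Num.Def.normr /= mx_normrE; apply: bigmax_le.
  exact: enorm_ge0.
by move=> [i j] _ /=; rewrite (ord1 i) coord_le_enorm.
Qed.


Lemma enormZ (a : R) u : enorm (a *: u) = `|a| * enorm u.
Proof.
apply/eqP; rewrite -(@eqrXn2 _ 2) ?mulr_ge0 ?enorm_ge0//.
by rewrite exprMn !enorm_sqr dotrZl dotrC dotrZl mulrA real_normK ?num_real// expr2.
Qed.

End Euclidean.

(** * The Hilbert product X * H * R^m *)

Section ProductInner.
Context (R : realType) (X H : hilbertType R) (m : nat).
Notation Z := (X * H * 'rV[R]_m)%type.
Notation ip := (@prod_inner R X H m).

Lemma prod_innerC u v : ip u v = ip v u.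
Proof. by rewrite /prod_inner innerC (innerC u.1.2) dotrC. Qed.

Lemma prod_innerDl u v w : ip (u + v) w = ip u w + ip v w.
Proof. by rewrite /prod_inner /= !innerDl dotrDl; ring. Qed.

Lemma prod_innerZl (a : R) u v : ip (a *: u) v = a * ip u v.
Proof. by rewrite /prod_inner /= !innerZl dotrZl; ring. Qed.

Lemma prod_inner_ge0 u : 0 <= ip u u.
Proof. by rewrite /prod_inner !addr_ge0 ?inner_ge0 ?dotr_ge0. Qed.

Lemma ler_prod_inner u v : `|ip u v| <= Num.sqrt (ip u u) * Num.sqrt (ip v v).
Proof. exact: cauchy_schwarz prod_innerC prod_innerDl prod_innerZl prod_inner_ge0 u v. Qed.

(** The product type carries the maximum norm, so the Riesz theorem does not apply to it directly;
    the representing vector is assembled from those of the two Hilbert restrictions and the values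
    on the basis of R^m. *)
Lemma riesz_prodP (l : Z -> R) (C : R) :
  linear l -> (forall w, `|l w| <= C * `|w|) ->
  forall w, ip (riesz ip l) w = l w.
Proof.
move=> llin lC.
suff [z zl] : exists z, forall w, ip z w = l w.
  exact: (xgetPex (0 : Z) (P := [set z | forall u, ip z u = l u])
    (ex_intro _ z zl)).
have [|x|x xl] := @riesz_representation R X (fun h => l (h, 0, 0)) C.
- move=> a u v; rewrite -llin; congr (l (_, _, _)); by rewrite /= scaler0 addr0.
- apply: le_trans (lC _) _; rewrite !prod_normE/= !normr0.
  by rewrite (max_l (normr_ge0 x)) (max_l (normr_ge0 x)).
have [|y|y yl] := @riesz_representation R H (fun h => l (0, h, 0)) C.
- move=> a u v; rewrite -llin; congr (l (_, _, _)); by rewrite /= scaler0 addr0.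
- apply: le_trans (lC _) _; rewrite !prod_normE/= !normr0.
  by rewrite (max_r (normr_ge0 y)) (max_l (normr_ge0 y)).
pose t : 'rV[R]_m := \row_i l (0, 0, delta_mx 0 i).
exists (x, y, t) => -[[h k] s]; rewrite /prod_inner /= xl yl.
have -> : dotr t s = l (0, 0, s).
  have tl : linear (fun s : 'rV[R]_m => l (0, 0, s)).
    by move=> a u v; rewrite -llin; congr (l (_, _, _)); rewrite /= scaler0 addr0.
  rewrite [in RHS](row_sum_delta s) /dotr.
  transitivity (\sum_i (s 0 i *: l (0, 0, delta_mx 0 i))).
    by apply: eq_bigr => i _; rewrite mxE mulrC.
  elim/big_rec2: _ => [|i a b _ ->]; first by rewrite (islin0 tl).
  by rewrite (islinD tl) (islinZ tl).
rewrite -!(islinD llin); congr (l (_, _, _)); by rewrite /= ?addr0 ?add0r.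
Qed.

End ProductInner.

(** * Frechet derivatives as a relation with an explicit candidate *)

Section Fderiv.
Context (R : realType).

Definition bounded_op (V W : normedModType R) (D : V -> W) :=
  linear D /\ exists2 C : R, 0 < C & forall h, `|D h| <= C * `|h|.

(** A relation rather than ['d], whose value is meaningful only once differentiability is known: the
    calculus rules below establish differentiability and compute D together, and [Fderiv_diff]
    returns to ['d]. *)
Definition Fderiv (V W : normedModType R) (f : V -> W) (x : V) (D : V -> W) :=
  bounded_op D /\ forall e : R, 0 < e ->
    \forall y \near x, `|f y - f x - D (y - x)| <= e * `|y - x|.

Lemma bounded_opW (V W : normedModType R) (D : V -> W) (C : R) :
  linear D -> (forall h, `|D h| <= C * `|h|) -> bounded_op D.
Proof.
move=> Dlin DC; split=> //; exists (`|C| + 1); first by rewrite ltr_wpDl.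
move=> h; apply: le_trans (DC h) _; rewrite ler_wpM2r//.
by rewrite ler_wpDr// ler_norm.
Qed.

Lemma bounded_op_comp (V W Y : normedModType R) (A : V -> W) (B : W -> Y) :
  bounded_op A -> bounded_op B -> bounded_op (B \o A).
Proof.
move=> [Al [a a0 aP]] [Bl [b b0 bP]]; apply: (@bounded_opW _ _ _ (b * a)).
  by move=> k u v /=; rewrite Al Bl.
move=> h /=; apply: le_trans (bP _) _; rewrite -mulrA ler_wpM2l//; exact: ltW.
Qed.

Lemma bounded_op_add (V W : normedModType R) (A B : V -> W) :
  bounded_op A -> bounded_op B -> bounded_op (fun h => A h + B h).
Proof.
move=> [Al [a a0 aP]] [Bl [b b0 bP]]; apply: (@bounded_opW _ _ _ (a + b)).
  by move=> k u v /=; rewrite Al Bl scalerDr addrACA.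
by move=> h; rewrite mulrDl; apply: le_trans (ler_normD _ _) (lerD _ _).
Qed.

Context (Z V W : normedModType R).
Implicit Types (f g : V -> W) (x : V).

Lemma Fderiv_eq f g x D D' : (\forall y \near x, f y = g y) ->
  (forall h, D h = D' h) -> Fderiv f x D -> Fderiv g x D'.
Proof.
move=> fg /funext <- [Db fD]; split=> // e e0.
have fgx : f x = g x by exact: nbhs_singleton fg.
by apply: filterS2 fg (fD e e0) => y <-; rewrite fgx.
Qed.

Lemma Fderiv_lipschitz f x D : Fderiv f x D ->
  exists2 C : R, 0 < C & \forall y \near x, `|f y - f x| <= C * `|y - x|.
Proof.
move=> [[_ [C C0 CP]] fD]; exists (C + 1); first exact: addr_gt0.
apply: filterS (fD 1 ltr01) => y; rewrite mul1r => fy.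
rewrite -(subrK (D (y - x)) (f y - f x)).
by apply: le_trans (ler_normD _ _) _; rewrite mulrDl mul1r addrC lerD.
Qed.

Lemma near_norm_le x (e : R) : 0 < e -> \forall y \near x, `|y - x| <= e.
Proof.
move=> e0; apply: filterS (nbhsx_ballx x e e0) => y.
by rewrite -ball_normE /ball_/= distrC; exact: ltW.
Qed.

Lemma Fderiv_continuous f x D : Fderiv f x D -> f y @[y --> x] --> f x.
Proof.
move=> /Fderiv_lipschitz[C C0 fC]; apply/cvgrPdist_le => e e0.
have := near_norm_le x (divr_gt0 e0 C0).
apply: filterS2 fC => y fy; rewrite ler_pdivlMr// mulrC => ye.
by rewrite distrC; exact: le_trans fy ye.
Qed.

Lemma Fderiv_linear (D : V -> W) x : bounded_op D -> Fderiv D x D.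
Proof.
move=> Db; split=> // e e0; near=> y.
by rewrite (islinB Db.1) subrr normr0 mulr_ge0// ltW.
Unshelve. all: by end_near. Qed.

Lemma Fderiv_cst (a : W) x : Fderiv (fun=> a) x (fun=> 0).
Proof.
split=> [|e e0].
  apply: (@bounded_opW _ _ _ 0) => [k u v|h]; rewrite ?scaler0 ?addr0//.
  by rewrite normr0 mul0r.
by near=> y; rewrite subrr subr0 normr0 mulr_ge0// ltW.
Unshelve. all: by end_near. Qed.

Lemma Fderiv_add f g x A B : Fderiv f x A -> Fderiv g x B ->
  Fderiv (fun y => f y + g y) x (fun h => A h + B h).
Proof.
move=> [Ab fA] [Bb gB]; split=> [|e e0]; first exact: bounded_op_add.
have e2 : 0 < e / 2 by rewrite divr_gt0.
apply: filterS2 (fA _ e2) (gB _ e2) => y fy gy.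
have -> : f y + g y - (f x + g x) - (A (y - x) + B (y - x)) =
    (f y - f x - A (y - x)) + (g y - g x - B (y - x)).
  by rewrite !opprD (addrACA (f y)); exact: addrACA.
by rewrite (splitr e) mulrDl; apply: le_trans (ler_normD _ _) (lerD _ _).
Qed.

Lemma Fderiv_sum n (f : 'I_n -> V -> W) x (A : 'I_n -> V -> W) :
  (forall i, Fderiv (f i) x (A i)) ->
  Fderiv (fun y => \sum_i f i y) x (fun h => \sum_i A i h).
Proof.
elim: n f A => [|n IH] f A fA.
  apply: Fderiv_eq (Fderiv_cst 0 x); first by near=> y; rewrite big_ord0.
  by move=> h; rewrite big_ord0.
apply: (@Fderiv_eq (fun y => f ord0 y + \sum_i f (lift ord0 i) y) _ _
  (fun h => A ord0 h + \sum_i A (lift ord0 i) h)).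
- by near=> y; rewrite big_ord_recl.
- by move=> h; rewrite big_ord_recl.
- by apply: Fderiv_add => //; apply: IH.
Unshelve. all: by end_near. Qed.

(** A second-order remainder is o(|y - x|). This suits 1/t and the squared positive part, whose
    remainders are estimated explicitly. *)
Lemma Fderiv_quadratic f x D (C : R) : bounded_op D ->
  (\forall y \near x, `|f y - f x - D (y - x)| <= C * `|y - x| ^+ 2) ->
  Fderiv f x D.
Proof.
move=> Db fC; split=> // e e0.
have C1 : 0 < `|C| + 1 by rewrite ltr_wpDl.
apply: filterS2 fC (near_norm_le x (divr_gt0 e0 C1)) => y fy.
rewrite ler_pdivlMr// => ye; apply: le_trans fy _.
rewrite expr2 mulrA ler_wpM2r// mulrC; apply: le_trans ye.
by rewrite ler_wpM2l// ler_wpDr// ler_norm.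
Qed.

Lemma Fderiv_diff f x D : Fderiv f x D ->
  differentiable f x /\ ('d f x = D :> (V -> W)).
Proof.
move=> [[Dl [C C0 DC]] fD].
pose L : {linear V -> W} := HB.pack D (GRing.isLinear.Build _ _ _ _ D Dl).
have Lc : continuous L.
  by move=> y; apply: Fderiv_continuous (Fderiv_linear y (bounded_opW Dl DC)).
have fL : f \o shift x = cst (f x) + L +o_ 0 id.
  apply/eqaddoP => e e0 /=.
  have := fD e e0.
  rewrite (near_shift 0 x); apply: filterS => y.
  by rewrite /= subr0 addrK !fctE/= opprD addrA.
have dL := diff_unique Lc fL.
by split=> //; apply/diff_locallyP; rewrite dL.
Qed.


Lemma diff_Fderiv f x : differentiable f x -> Fderiv f x ('d f x).
Proof.
move=> fx; have [C C0 CP] := linear_lipschitz (diff_continuous fx).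
split=> [|e e0]; first by apply: bounded_opW CP => a u v; rewrite linearP.
have /diff_locallyP[_ /eqaddoP fo] := fx.
have h0 : \forall h \near (0 : V), `|f (h + x) - (f x + 'd f x h)| <= e * `|h|.
  exact: fo.
move: h0; rewrite (near_shift x 0); apply: filterS => y.
by rewrite /= sub0r subrK opprD addrA.
Qed.

End Fderiv.

(** * Chain rule and product rules *)

Section FderivComp.
Context (R : realType) (Z V W : normedModType R).

(** The outer map is expanded relative to A only, because phi is differentiable merely within its
    domain, one-sidedly at 0, and |F|^2 does take the value 0. *)
Lemma Fderiv_comp_within (A : set V) (f : V -> W) (P : Z -> V) z B D :
  Fderiv P z B -> (\forall y \near z, A (P y)) -> bounded_op D ->
  (forall e : R, 0 < e -> \forall v \near within A (nbhs (P z)),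
     `|f v - f (P z) - D (v - P z)| <= e * `|v - P z|) ->
  Fderiv (f \o P) z (D \o B).
Proof.
move=> PB AP Db fD; have [C C0 CP] := Fderiv_lipschitz PB.
have Pc := Fderiv_continuous PB; case: PB => Bb PB.
split=> [|e e0]; first exact: bounded_op_comp.
case: (Db) => Dl [d d0 dP].
have e1 : 0 < e / 2 / C by rewrite !divr_gt0.
have e2 : 0 < e / 2 / d by rewrite !divr_gt0.
have fP := Pc _ (fD _ e1).
near=> y.
have Ay : A (P y) by near: y.
have fy : `|f (P y) - f (P z) - D (P y - P z)| <= e / 2 / C * `|P y - P z|.
  by move: Ay; near: y.
have Py : `|P y - P z| <= C * `|y - z| by near: y.
have By : `|P y - P z - B (y - z)| <= e / 2 / d * `|y - z|.
  by near: y; exact: PB.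
have -> : (f \o P) y - (f \o P) z - (D \o B) (y - z) =
    (f (P y) - f (P z) - D (P y - P z)) + D (P y - P z - B (y - z)).
  by rewrite (islinB Dl (P y - P z)) /= addrA subrK.
rewrite (splitr e) mulrDl.
apply: le_trans (ler_normD _ _) (lerD _ _).
  apply: le_trans fy _.
  have -> : e / 2 * `|y - z| = e / 2 / C * (C * `|y - z|) by field; rewrite gt_eqF.
  by rewrite ler_wpM2l ?(ltW e1).
apply: le_trans (dP _) _.
have -> : e / 2 * `|y - z| = d * (e / 2 / d * `|y - z|) by field; rewrite gt_eqF.
by rewrite ler_wpM2l ?(ltW d0).
Unshelve. all: by end_near. Qed.

Lemma Fderiv_comp (f : V -> W) (P : Z -> V) z B D :
  Fderiv P z B -> Fderiv f (P z) D -> Fderiv (f \o P) z (D \o B).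
Proof.
move=> PB [Db fD]; apply: (Fderiv_comp_within (A := setT) PB) => //.
  exact: filterE.
by move=> e e0; apply: filterS (fD e e0) => v fv _.
Qed.


Definition bounded_bilin (V E W : normedModType R) (b : V -> E -> W) :=
  [/\ forall k, linear (b k), forall l, linear (b^~ l) &
      exists2 C : R, 0 < C & forall k l, `|b k l| <= C * `|k| * `|l|].

(* The derivative of an operator-valued map, in operator norm: A' k l is the
   value at l of the derivative of A in the direction k. *)
Definition Fderiv_op (V E W : normedModType R) (A : V -> E -> W) (x : V)
    (A' : V -> E -> W) :=
  [/\ bounded_op (A x), bounded_bilin A' &
      forall e : R, 0 < e -> \forall y \near x, forall l,
        `|A y l - A x l - A' (y - x) l| <= e * `|y - x| * `|l|].

(** The product rule for an operator and its argument that both move. It is needed for DF(x)^*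
    lambda and for DF(x) applied to grad L. *)
Lemma Fderiv_app (E : normedModType R) (A A' : V -> E -> W)
    (P : Z -> V) (Q : Z -> E) z B D :
  Fderiv P z B -> Fderiv Q z D -> Fderiv_op A (P z) A' ->
  Fderiv (fun w => A (P w) (Q w)) z (fun h => A' (B h) (Q z) + A (P z) (D h)).
Proof.
move=> PB QD [Ab [A'l A'r [a a0 aP]] fA].
have [c c0 cP] := Fderiv_lipschitz PB.
have Pc := Fderiv_continuous PB; have Qc := Fderiv_continuous QD.
case: PB => -[Bl [b b0 bP]] PB; case: QD => Db QD.
split=> [|e e0].
  apply: bounded_op_add; last exact: bounded_op_comp Db Ab.
  apply: (@bounded_opW _ _ _ _ (a * b * `|Q z|)) => [k u v|h].
    by rewrite Bl (A'r _ k).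
  apply: le_trans (aP _ _) _.
  rewrite [leRHS]mulrAC ler_wpM2r// -mulrA ler_wpM2l// ltW//.
case: (Ab) => Al [d d0 dP].
(* This bounds |Q y| for y near z. Each tolerance below is e / 4 divided by the bounds on the other
   factors of one of the four error terms. *)
set q := `|Q z| + 1; have q0 : 0 < q by rewrite ltr_wpDl.
have e4 : 0 < e / 4 by rewrite divr_gt0.
have e1 : 0 < e / 4 / (c * q) by rewrite divr_gt0// mulr_gt0.
have e2 : 0 < e / 4 / (a * q) by rewrite divr_gt0// mulr_gt0.
have e3 : 0 < e / 4 / (a * b) by rewrite divr_gt0// mulr_gt0.
have e5 : 0 < e / 4 / d by rewrite divr_gt0.
have fP := Pc _ (fA _ e1).
near=> y.
have h1 : forall l, `|A (P y) l - A (P z) l - A' (P y - P z) l| <=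
  e / 4 / (c * q) * `|P y - P z| * `|l| by near: y.
have h2 : `|P y - P z| <= c * `|y - z| by near: y.
have h3 : `|P y - P z - B (y - z)| <= e / 4 / (a * q) * `|y - z|.
  by near: y; exact: PB.
have h4 : `|Q y - Q z - D (y - z)| <= e / 4 / d * `|y - z|.
  by near: y; exact: QD.
have h5 : `|Q y - Q z| <= e / 4 / (a * b).
  by rewrite distrC; near: y; move/cvgrPdist_le: Qc; apply.
have h6 : `|Q y| <= q.
  rewrite -(subrK (Q z) (Q y)) addrC; apply: le_trans (ler_normD _ _) _.
  by rewrite lerD2l distrC; near: y; move/cvgrPdist_le: Qc; apply.
(* The four errors: expansion of A at the moved argument, expansion of P inside A', variation of Q
   inside A', expansion of Q. *)
have -> : A (P y) (Q y) - A (P z) (Q z)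
    - (A' (B (y - z)) (Q z) + A (P z) (D (y - z))) =
  (A (P y) (Q y) - A (P z) (Q y) - A' (P y - P z) (Q y)) +
  A' (P y - P z - B (y - z)) (Q y) + A' (B (y - z)) (Q y - Q z) +
  A (P z) (Q y - Q z - D (y - z)).
  rewrite (islinB (A'r (Q y)) (P y - P z)) (islinB (A'l (B (y - z)))).
  rewrite !(islinB Al).
  move: (A (P y) _) (A (P z) (Q y)) (A (P z) (Q z)) (A' (P y - P z) _)
    (A' (B _) (Q y)) (A' (B _) (Q z)) (A (P z) (D _)) => t1 t2 t3 t4 t5 t6 t7.
  by rewrite opprD !addrA !subrK (addrAC (t1 - t2)) subrK (addrAC t1 (- t6)).
have -> : e * `|y - z| = e / 4 * `|y - z| + e / 4 * `|y - z| + e / 4 * `|y - z|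
   + e / 4 * `|y - z| by field.
have yz0 := normr_ge0 (y - z).
apply: le_trans (ler_normD _ _) (lerD _ _);
  first apply: le_trans (ler_normD _ _) (lerD _ _);
  first apply: le_trans (ler_normD _ _) (lerD _ _).
- apply: le_trans (h1 _) _.
  apply: (@le_trans _ _ (e / 4 / (c * q) * (c * `|y - z|) * q)).
    apply: ler_pM => //; first by rewrite mulr_ge0 ?(ltW e1).
    by apply: ler_wpM2l => //; exact: ltW.
  by rewrite le_eqVlt; apply/orP; left; apply/eqP; field; rewrite !gt_eqF.
- apply: le_trans (aP _ _) _.
  apply: (@le_trans _ _ (a * (e / 4 / (a * q) * `|y - z|) * q)).
    apply: ler_pM => //; first by rewrite mulr_ge0 ?(ltW a0).
    by apply: ler_wpM2l => //; exact: ltW.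
  by rewrite le_eqVlt; apply/orP; left; apply/eqP; field; rewrite !gt_eqF.
- apply: le_trans (aP _ _) _.
  apply: (@le_trans _ _ (a * (b * `|y - z|) * (e / 4 / (a * b)))).
    apply: ler_pM => //; first by rewrite mulr_ge0 ?(ltW a0).
    by apply: ler_wpM2l => //; exact: ltW.
  by rewrite le_eqVlt; apply/orP; left; apply/eqP; field; rewrite !gt_eqF.
- apply: le_trans (dP _) _.
  apply: (@le_trans _ _ (d * (e / 4 / d * `|y - z|))).
    by rewrite ler_wpM2l ?(ltW d0).
  by rewrite le_eqVlt; apply/orP; left; apply/eqP; field; rewrite gt_eqF.
Unshelve. all: by end_near. Qed.

Lemma bounded_bilinW (b : Z -> V -> W) (C : R) :
  (forall k, linear (b k)) -> (forall l, linear (b^~ l)) ->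
  (forall k l, `|b k l| <= C * `|k| * `|l|) -> bounded_bilin b.
Proof.
move=> bl br bC; split=> //; exists (`|C| + 1); first by rewrite ltr_wpDl.
move=> k l; apply: le_trans (bC _ _) _; rewrite ler_wpM2r// ler_wpM2r//.
by rewrite ler_wpDr// ler_norm.
Qed.

Lemma bounded_bilin_Fderiv_op (b : Z -> V -> W) x :
  bounded_bilin b -> Fderiv_op b x b.
Proof.
move=> bb; case: (bb) => bl br [C C0 CP]; split=> //.
  by apply: (@bounded_opW _ _ _ _ (C * `|x|)) => // h; exact: CP.
move=> e e0; near=> y => l.
by rewrite (islinB (br l)) subrr normr0 !mulr_ge0// ltW.
Unshelve. all: by end_near. Qed.

End FderivComp.

(** A bounded bilinear map is its own operator derivative in the first slot, so the rules for
    products, inner products and scalings are instances of [Fderiv_app]. *)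
Lemma Fderiv_bilin (R : realType) (Z V E W : normedModType R)
    (b : V -> E -> W) (P : Z -> V) (Q : Z -> E) z B D :
  bounded_bilin b -> Fderiv P z B -> Fderiv Q z D ->
  Fderiv (fun w => b (P w) (Q w)) z (fun h => b (B h) (Q z) + b (P z) (D h)).
Proof.
by move=> bb PB QD; apply: Fderiv_app PB QD (bounded_bilin_Fderiv_op _ bb).
Qed.

Section FderivReal.
Context (R : realType) (Z : normedModType R).
Implicit Types (u v : Z -> R).

Lemma Fderiv_mul u v z A B : Fderiv u z A -> Fderiv v z B ->
  Fderiv (fun w => u w * v w) z (fun h => A h * v z + u z * B h).
Proof.
apply: Fderiv_bilin; apply: (@bounded_bilinW _ _ _ _ _ 1) => [k|l|k l].
- by move=> a s t; rewrite mulrDr mulrCA.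
- by move=> a s t; rewrite mulrDl -mulrA.
- by rewrite mul1r normrM.
Qed.

Lemma Fderiv_inner (X : hilbertType R) (P Q : Z -> X) z A B :
  Fderiv P z A -> Fderiv Q z B ->
  Fderiv (fun w => inner (P w) (Q w)) z
    (fun h => inner (A h) (Q z) + inner (P z) (B h)).
Proof.
apply: Fderiv_bilin; apply: (@bounded_bilinW _ _ _ _ _ 1) => [k|l|k l].
- by move=> a s t; rewrite innerDr innerZr.
- by move=> a s t; rewrite innerDl innerZl.
- by rewrite mul1r ler_inner.
Qed.

Lemma Fderiv_scale (W : normedModType R) u (Q : Z -> W) z A B :
  Fderiv u z A -> Fderiv Q z B ->
  Fderiv (fun w => u w *: Q w) z (fun h => A h *: Q z + u z *: B h).
Proof.
apply: (@Fderiv_bilin _ _ _ _ _ (fun (a : R) (q : W) => a *: q)).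
apply: (@bounded_bilinW _ _ _ _ _ 1) => [k|l|k l].
- by move=> a s t; rewrite scalerDr !scalerA mulrC.
- by move=> a s t; rewrite scalerDl scalerA.
- by rewrite mul1r normrZ.
Qed.

Lemma mul_bounded_op (a : R) : bounded_op (fun t : R => a * t).
Proof.
apply: (@bounded_opW _ _ _ _ `|a|) => [k s t|h]; last by rewrite normrM.
by rewrite mulrDr mulrCA.
Qed.

Lemma Fderiv_inv u z A : u z != 0 -> Fderiv u z A ->
  Fderiv (fun w => (u w)^-1) z (fun h => - (u z)^-1 ^+ 2 * A h).
Proof.
move=> uz0 uA.
change (Fderiv ((fun t : R => t^-1) \o u) z
  ((fun t : R => - (u z)^-1 ^+ 2 * t) \o A)).
apply: Fderiv_comp => //; apply: (@Fderiv_quadratic _ _ _ _ _ _ (2 * `|u z|^-1 ^+ 3)).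
  exact: mul_bounded_op.
have a0 : 0 < `|u z| by rewrite normr_gt0.
have a2 : 0 < `|u z| / 2 by rewrite divr_gt0.
(* Within distance |u z| / 2 one has |t| >= |u z| / 2, which bounds 1/t in the exact remainder (t -
   u z)^2 / (t (u z)^2). *)
apply: filterS (near_norm_le (u z) a2) => t tu.
have tu2 : `|u z| / 2 <= `|t|.
  have := ler_normD (u z - t) t; rewrite subrK distrC; lra.
have t0 : t != 0 by rewrite -normr_gt0; exact: lt_le_trans a2 tu2.
have -> : t^-1 - (u z)^-1 - - (u z)^-1 ^+ 2 * (t - u z) =
  t^-1 * ((u z)^-1 ^+ 2 * (t - u z) ^+ 2) by field; rewrite t0 uz0.
have ht : `|t|^-1 <= 2 * `|u z|^-1.
  rewrite -[leRHS]invrK lef_pV2 ?posrE ?normr_gt0 ?invr_gt0 ?mulr_gt0 ?invr_gt0//.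
  by rewrite invfM invrK mulrC.
have -> : `|t^-1 * ((u z)^-1 ^+ 2 * (t - u z) ^+ 2)| =
    `|t|^-1 * (`|u z|^-1 ^+ 2 * `|t - u z| ^+ 2).
  by rewrite normrM normfV [X in _ * X = _]normrM 2!normrX normfV.
have -> : 2 * `|u z|^-1 ^+ 3 * `|t - u z| ^+ 2 =
    2 * `|u z|^-1 * (`|u z|^-1 ^+ 2 * `|t - u z| ^+ 2) by ring.
by apply: ler_wpM2r ht; rewrite mulr_ge0// exprn_ge0// invr_ge0.
Qed.

(* The squared positive part is C^1, which smoothes the max in the penalty term. *)
Lemma Fderiv_maxr0_sqr u z A : Fderiv u z A ->
  Fderiv (fun w => Num.max (u w) 0 ^+ 2) z (fun h => 2 * Num.max (u z) 0 * A h).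
Proof.
move=> uA.
change (Fderiv ((fun t : R => Num.max t 0 ^+ 2) \o u) z
  ((fun t : R => 2 * Num.max (u z) 0 * t) \o A)).
apply: Fderiv_comp => //; apply: (@Fderiv_quadratic _ _ _ _ _ _ 1); first exact: mul_bounded_op.
near=> t; rewrite mul1r real_normK ?num_real// ler_norml.
case: (leP t 0) => t0; case: (leP (u z) 0) => u0;
  rewrite ?(max_r t0) ?(max_l (ltW t0)) ?(max_r u0) ?(max_l (ltW u0));
  move: (sqr_ge0 (t - u z)) (sqr_ge0 t) (sqr_ge0 (u z)) => ? ? ?;
  apply/andP; split; nra.
Unshelve. all: by end_near. Qed.

End FderivReal.

(** * Derivatives of gradients and of adjoint operators *)

Section SecondOrder.
Context (R : realType).

Lemma diff_Fderiv_op (V W : normedModType R) (f : V -> W) x B :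
  differentiable f x -> is_diff2 f x B -> Fderiv_op (fun y => 'd f y) x B.
Proof.
move=> fx [Bl Br [C CP] fB]; split=> //; first by case: (diff_Fderiv fx).
exact: bounded_bilinW Bl Br CP.
Qed.

Context (X : hilbertType R).

Lemma riesz_comb (l1 l2 : X -> R) (a : R) :
  bounded_op l1 -> bounded_op l2 ->
  riesz inner (fun u => a * l1 u + l2 u) = a *: riesz inner l1 + riesz inner l2.
Proof.
move=> [l1l [C1 _ C1P]] [l2l [C2 _ C2P]].
by apply: rieszE => u; rewrite innerDl innerZl (rieszP l1l C1P) (rieszP l2l C2P).
Qed.

Lemma bounded_bilin_opl (V E W : normedModType R) (B : V -> E -> W) k :
  bounded_bilin B -> bounded_op (B k).
Proof.
by move=> [Bl Br [C C0 CP]]; apply: (@bounded_opW _ _ _ _ (C * `|k|)).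
Qed.

Lemma riesz_bounded_op (V : normedModType R) (B : V -> X -> R) :
  bounded_bilin B -> bounded_op (fun k => riesz inner (B k)).
Proof.
move=> Bb; case: (Bb) => Bl Br [C C0 CP].
apply: (@bounded_opW _ _ _ _ C) => [a u v|k]; last first.
  apply: norm_riesz (Bl k) (CP k); by rewrite mulr_ge0// ltW.
rewrite -(riesz_comb _ (bounded_bilin_opl u Bb) (bounded_bilin_opl v Bb)).
by congr riesz; apply/funext => w; rewrite (Br w).
Qed.

(** The Riesz map is linear and does not increase norms, so the remainder of the gradient is the
    Riesz vector of the remainder of ['d f]. *)
Lemma Fderiv_grad (f : X -> R) x B :
  (forall y, differentiable f y) -> is_diff2 f x B ->
  Fderiv (grad f) x (fun k => riesz inner (B k)).
Proof.
move=> df fB; have [fx Bb estB] := diff_Fderiv_op (df x) fB.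
split=> [|e e0]; first exact: riesz_bounded_op.
case: (Bb) => Bl Br [C C0 CP].
apply: filterS (estB e e0) => y yP.
have -> : grad f y - grad f x - riesz inner (B (y - x)) =
    riesz inner (fun u => 'd f y u - 'd f x u - B (y - x) u).
  apply/esym/rieszE => u.
  by rewrite !innerBl !gradP// (rieszP (Bl _) (CP _)).
apply: norm_riesz yP; first by rewrite mulr_ge0// ltW.
move=> a u v; rewrite !linearP (Bl (y - x)) /=.
rewrite !scalerBr.
by rewrite /GRing.scale/=; ring.
Qed.

Context (H : hilbertType R).

Lemma adjoint_bounded_op (A : X -> H) : bounded_op A -> bounded_op (adjoint A).
Proof.
move=> [Al [C C0 leA]]; apply: (@bounded_opW _ _ _ _ C).
  exact: adjoint_linear Al leA.
by move=> l; apply: norm_adjoint => //; exact: ltW.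
Qed.

Lemma bounded_inner_adjoint (A : X -> H) l u : bounded_op A ->
  inner (adjoint A l) u = inner l (A u).
Proof. by move=> [Al [C _ leA]]; exact: inner_adjoint Al leA l u. Qed.

(** Same principle as for gradients: taking adjoints is linear and does not increase the operator
    norm. *)
Lemma Fderiv_op_adjoint (F : X -> H) x B :
  (forall y, differentiable F y) -> is_diff2 F x B ->
  Fderiv_op (fun y => adjoint ('d F y)) x (fun k => adjoint (B k)).
Proof.
move=> Fd BF; have [Fx Bb estB] := diff_Fderiv_op (Fd x) BF.
have Fdb y : bounded_op ('d F y) by case: (diff_Fderiv (Fd y)).
case: (Bb) => Bl Br [C C0 CP].
have Bkb k : bounded_op (B k) := bounded_bilin_opl k Bb.
split; first exact: adjoint_bounded_op.
- apply: (@bounded_bilinW _ _ _ _ _ C) => [k|l|k l].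
  + by case: (adjoint_bounded_op (Bkb k)).
  + move=> a u v; apply: inner_inj => w.
    rewrite innerDl innerZl !bounded_inner_adjoint// (Br w) innerDr innerZr.
    by [].
  + by apply: norm_adjoint => //; rewrite mulr_ge0// ltW.
- move=> e e0; apply: filterS (estB e e0) => y yP l.
  have Db : bounded_op (fun u => 'd F y u - 'd F x u - B (y - x) u).
    apply: (@bounded_opW _ _ _ _ (e * `|y - x|)) => // a u v.
    rewrite !linearP (Bl (y - x)) /= !scalerBr.
    by rewrite !opprD (addrACA (a *: _)) scalerN; exact: addrACA.
  have -> : adjoint ('d F y) l - adjoint ('d F x) l - adjoint (B (y - x)) l =
      adjoint (fun u => 'd F y u - 'd F x u - B (y - x) u) l.
    apply: inner_inj => u.
    by rewrite !innerBl !bounded_inner_adjoint// !innerBr.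
  apply: norm_adjoint yP l _; first by case: Db.
  by rewrite mulr_ge0// ltW.
Qed.

End SecondOrder.

(** * The derivative of eta *)

Section EtaDerivative.
Context (R : realType) (X H : hilbertType R) (m : nat).
Notation Z := (X * H * 'rV[R]_m)%type.

Lemma norm_pX (w : Z) : `|w.1.1| <= `|w|.
Proof. by rewrite !prod_normE !le_max lexx. Qed.

Lemma norm_pH (w : Z) : `|w.1.2| <= `|w|.
Proof. by rewrite !prod_normE !le_max lexx orbT. Qed.

Lemma norm_pM (w : Z) : `|w.2| <= `|w|.
Proof. by rewrite prod_normE le_max lexx orbT. Qed.

Lemma Fderiv_pX (w : Z) : Fderiv (fun w : Z => w.1.1) w (fun k => k.1.1).
Proof.
apply: Fderiv_linear; apply: (@bounded_opW _ _ _ _ 1) => // h.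
by rewrite mul1r norm_pX.
Qed.

Lemma Fderiv_pH (w : Z) : Fderiv (fun w : Z => w.1.2) w (fun k => k.1.2).
Proof.
apply: Fderiv_linear; apply: (@bounded_opW _ _ _ _ 1) => // h.
by rewrite mul1r norm_pH.
Qed.

Lemma Fderiv_pM i (w : Z) :
  Fderiv (fun w : Z => w.2 0 i) w (fun k => k.2 0 i).
Proof.
apply: (@Fderiv_linear _ _ _ (fun w : Z => w.2 0 i)).
apply: (@bounded_opW _ _ _ _ 1) => [a u v|h]; first by rewrite !mxE.
by rewrite mul1r; apply: le_trans (coord_le_norm _ _) (norm_pM _).
Qed.

Lemma Fderiv_compX (W : normedModType R) (h : X -> W) (w : Z) D :
  Fderiv h w.1.1 D -> Fderiv (fun w => h w.1.1) w (fun k => D k.1.1).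
Proof. exact: (@Fderiv_comp _ _ _ _ h _ w _ D (Fderiv_pX w)). Qed.

Context (f : X -> R) (F : X -> H) (g : 'I_m -> X -> R).
Context (fd : forall y, differentiable f y).
Context (gd : forall i y, differentiable (g i) y).
Context (Fd : forall y, differentiable F y).

Lemma diff_bounded_op (V W : normedModType R) (h : V -> W) y :
  differentiable h y -> bounded_op ('d h y).
Proof. by move=> /diff_Fderiv[]. Qed.

Lemma Fderiv_lagr x lam mu : Fderiv (fun y => lagr f F g y lam mu) x
  (fun k => 'd f x k + inner lam ('d F x k) + \sum_i mu 0 i * 'd (g i) x k).
Proof.
have h i := Fderiv_mul (Fderiv_cst (mu 0 i) x) (diff_Fderiv (gd i x)).
have := Fderiv_add (Fderiv_add (diff_Fderiv (fd x))
  (Fderiv_inner (Fderiv_cst lam x) (diff_Fderiv (Fd x)))) (Fderiv_sum h).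
apply: Fderiv_eq => [|k].
  near=> y; rewrite /lagr; congr (_ + _).
  by apply: eq_bigr => i _; rewrite mxE.
rewrite inner0l add0r; congr (_ + _).
by apply: eq_bigr => i _; rewrite mul0r add0r.
Unshelve. all: by end_near. Qed.

Lemma grad_lagrE x lam mu : grad_lagr f F g x lam mu =
  grad f x + adjoint ('d F x) lam + \sum_i mu 0 i *: grad (g i) x.
Proof.
apply: rieszE => u; have [_ ->] := Fderiv_diff (Fderiv_lagr x lam mu).
rewrite !innerDl inner_suml (gradP (fd x)) bounded_inner_adjoint.
  by congr (_ + _); apply: eq_bigr => i _; rewrite innerZl gradP.
exact: diff_bounded_op.
Qed.

Lemma inner_grad_lagr x lam mu u : inner (grad_lagr f F g x lam mu) u =
  'd f x u + inner lam ('d F x u) + \sum_i mu 0 i * 'd (g i) x u.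
Proof.
rewrite grad_lagrE !innerDl inner_suml (gradP (fd x)) bounded_inner_adjoint.
  by congr (_ + _); apply: eq_bigr => i _; rewrite innerZl gradP.
exact: diff_bounded_op.
Qed.

Lemma grad_lagrQ x lam mu :
  grad_lagr f F g x lam mu = grad f x + Qdir F g x lam mu.
Proof. by rewrite grad_lagrE -addrA. Qed.

Context (x : X) (lam : H) (mu : 'rV[R]_m).
Context (Bf : X -> X -> R) (BF : X -> X -> H) (Bg : 'I_m -> X -> X -> R).
Context (fB : is_diff2 f x Bf) (FB : is_diff2 F x BF).
Context (gB : forall i, is_diff2 (g i) x (Bg i)).
Notation w0 := ((x, lam, mu) : Z).
Notation G := (grad_lagr f F g x lam mu).

(** The x-direction enters through second derivatives only. The multiplier directions enter through
    DF^* and the gradients of the g_i, as L is affine in the multipliers. *)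
Definition dgrad_lagr (k : Z) : X :=
  riesz inner (Bf k.1.1) + (adjoint (BF k.1.1) lam + adjoint ('d F x) k.1.2) +
  \sum_i (k.2 0 i *: grad (g i) x + mu 0 i *: riesz inner (Bg i k.1.1)).

Lemma Fderiv_grad_lagr :
  Fderiv (fun w : Z => grad_lagr f F g w.1.1 w.1.2 w.2) w0 dgrad_lagr.
Proof.
have gF := @Fderiv_compX _ _ w0 _ (Fderiv_grad fd fB).
have gg i := @Fderiv_compX _ _ w0 _ (Fderiv_grad (gd i) (gB i)).
have gs i := Fderiv_scale (Fderiv_pM i w0) (gg i).
have ga := Fderiv_app (P := fun w : Z => w.1.1) (z := w0) (Fderiv_pX w0)
  (Fderiv_pH w0) (Fderiv_op_adjoint Fd FB).
have := Fderiv_add (Fderiv_add gF ga) (Fderiv_sum gs).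
by apply: Fderiv_eq => [|k//]; near=> w; rewrite grad_lagrE.
Unshelve. all: by end_near. Qed.

Definition etaF : H := 'd F x G.
Definition etag : 'rV[R]_m :=
  \row_i (inner (grad (g i) x) G + g i x ^+ 2 * mu 0 i).

Definition detaF (k : Z) : H := BF k.1.1 G + 'd F x (dgrad_lagr k).
Definition detag i (k : Z) : R :=
  inner (riesz inner (Bg i k.1.1)) G + inner (grad (g i) x) (dgrad_lagr k) +
  (2 * g i x * 'd (g i) x k.1.1 * mu 0 i + g i x ^+ 2 * k.2 0 i).

Lemma Fderiv_sqr (V : normedModType R) (u : V -> R) z A : Fderiv u z A ->
  Fderiv (fun y => u y ^+ 2) z (fun h => 2 * u z * A h).
Proof.
move=> uA; have := Fderiv_mul uA uA; apply: Fderiv_eq => [|h]; last by ring.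
by near=> y; rewrite expr2.
Unshelve. all: by end_near. Qed.

Lemma Fderiv_half_normsqr (V : normedModType R) (Y : hilbertType R) (u : V -> Y) z A :
  Fderiv u z A -> Fderiv (fun y => 2^-1 * `|u y| ^+ 2) z (fun h => inner (u z) (A h)).
Proof.
move=> uA; have := Fderiv_mul (Fderiv_cst (2^-1 : R) z) (Fderiv_inner uA uA).
apply: Fderiv_eq => [|h].
  by near=> y; rewrite inner_normE.
by rewrite mul0r add0r (innerC (A h)); field.
Unshelve. all: by end_near. Qed.

Definition deta (k : Z) : R :=
  inner etaF (detaF k) + \sum_i etag 0 i * detag i k.

Lemma Fderiv_eta :
  Fderiv (fun w : Z => eta_pen f F g w.1.1 w.1.2 w.2) w0 deta.
Proof.
have Gd := Fderiv_grad_lagr.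
have Ud : Fderiv (fun w : Z => 'd F (w.1.1) (grad_lagr f F g w.1.1 w.1.2 w.2)) w0 detaF.
  exact: (Fderiv_app (P := fun w : Z => w.1.1) (z := w0) (Fderiv_pX w0) Gd
    (diff_Fderiv_op (Fd x) FB)).
have gg i := @Fderiv_compX _ _ w0 _ (Fderiv_grad (gd i) (gB i)).
have g2 i := Fderiv_sqr (@Fderiv_compX _ _ w0 _ (diff_Fderiv (gd i x))).
have Vd i := Fderiv_add (Fderiv_inner (gg i) Gd) (Fderiv_mul (g2 i) (Fderiv_pM i w0)).
have := Fderiv_add (Fderiv_half_normsqr Ud)
  (Fderiv_mul (Fderiv_cst (2^-1 : R) w0) (Fderiv_sum (fun i => Fderiv_sqr (Vd i)))).
apply: Fderiv_eq => [|k]; first by near=> w.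
rewrite /deta; congr (_ + _); rewrite mul0r add0r mulr_sumr.
apply: eq_bigr => i _; rewrite mxE /detag/=.
by field.
Unshelve. all: by end_near. Qed.


(** In a pure multiplier direction the derivative of grad L is w of that direction. Choosing (u, v)
    itself and moving DF and the gradients to the other side of the inner products turns the pairing
    into |w(u, v)|^2. *)
Lemma deta_dual : deta (0, etaF, etag) =
  `|Qdir F g x etaF etag| ^+ 2 + \sum_i g i x ^+ 2 * etag 0 i ^+ 2.
Proof.
have [_ [_ fBr _] _] := diff_Fderiv_op (fd x) fB.
have [_ [_ FBr _] _] := diff_Fderiv_op (Fd x) FB.
have r0 : riesz inner (fun=> 0) = 0 :> X by apply: rieszE => u; rewrite inner0l.
have f0 : Bf 0 = fun=> 0 by apply/funext => l; exact: islin0 (fBr l).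
have F0 : BF 0 = fun=> 0 by apply/funext => l; exact: islin0 (FBr l).
have g0 i : Bg i 0 = fun=> 0.
  have [_ [_ gBr _] _] := diff_Fderiv_op (gd i x) (gB i).
  by apply/funext => l; exact: islin0 (gBr l).
have dG : dgrad_lagr (0, etaF, etag) = Qdir F g x etaF etag.
  rewrite /dgrad_lagr /= f0 F0 r0 add0r /Qdir; congr (_ + _).
    rewrite -[RHS]add0r; congr (_ + _).
    by apply: rieszE => u; rewrite inner0l inner0r.
  by apply: eq_bigr => i _; rewrite g0 r0 scaler0 addr0.
rewrite /deta /detaF /detag /= dG F0 add0r.
set q := Qdir _ _ _ _ _.
have qq : `|q| ^+ 2 =
    inner etaF ('d F x q) + \sum_i etag 0 i * inner (grad (g i) x) q.
  rewrite -inner_normE {1}/q innerDl inner_suml bounded_inner_adjoint.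
    by congr (_ + _); apply: eq_bigr => i _; rewrite innerZl.
  exact: diff_bounded_op.
rewrite qq -addrA -big_split; congr (_ + _); apply: eq_bigr => i _ /=.
by rewrite g0 r0 inner0l linear0; ring.
Qed.

(** [M1] bounds |grad L| and also its x-derivative. The first summand then bounds the x-derivative
    of u, the second the sum over the m coordinates of v. *)
Definition eta_const (M : R) : R := let M1 := M + M * M + m%:R * (M * M) in
  2 * M * M1 + m%:R * (2 * M * M1 + 2 * M * M * M).

(** Since eta is half the squared norm of (u, v), its derivative is linear in (u, v); the bound is
    therefore proportional to the residuals, which are controlled separately. *)
Lemma deta_primal_le (M : R) h : 0 <= M -> `|lam| <= M -> (forall i, `|mu 0 i| <= M) ->
  (forall i, `|g i x| <= M) ->
  (forall k, `|'d f x k| <= M * `|k|) -> (forall k, `|'d F x k| <= M * `|k|) ->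
  (forall i k, `|'d (g i) x k| <= M * `|k|) ->
  (forall k l, `|Bf k l| <= M * `|k| * `|l|) ->
  (forall k l, `|BF k l| <= M * `|k| * `|l|) ->
  (forall i k l, `|Bg i k l| <= M * `|k| * `|l|) ->
  `|deta (h, 0, 0)| <= eta_const M * (`|etaF| + enorm etag) * `|h|.
Proof.
move=> M0 lM mM gM f1 F1 g1 f2 F2 g2.
have [_ [fBl _ _] _] := diff_Fderiv_op (fd x) fB.
have [_ [FBl _ _] _] := diff_Fderiv_op (Fd x) FB.
have gBl i k : linear (Bg i k) by have [_ [+ _ _] _] := diff_Fderiv_op (gd i x) (gB i).
set M1 := M + M * M + m%:R * (M * M).
have M10 : 0 <= M1 by rewrite !addr_ge0 ?mulr_ge0.
have sumM (a : 'I_m -> X) (b : R) : (forall i, `|a i| <= b) ->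
    `|\sum_i a i| <= m%:R * b.
  move=> ab; apply: le_trans (ler_norm_sum _ _ _) _.
  apply: le_trans (ler_sum _ (fun i _ => ab i)) _.
  by rewrite sumr_const card_ord mulr_natl.
have ggM i : `|grad (g i) x| <= M by apply: norm_grad.
have GM : `|G| <= M1.
  rewrite grad_lagrE; apply: le_trans (ler_normD _ _) (lerD _ _).
    apply: le_trans (ler_normD _ _) (lerD _ _); first exact: norm_grad.
    apply: le_trans (norm_adjoint _ F1 _ M0) _.
      by move=> a u v; rewrite linearP.
    exact: ler_wpM2l.
  by apply: sumM => i; rewrite normrZ ler_pM.
have dGM : `|dgrad_lagr (h, 0, 0)| <= M1 * `|h|.
  rewrite /dgrad_lagr /= (_ : adjoint ('d F x) 0 = 0) ?addr0; last first.
    by apply: rieszE => u; rewrite !inner0l.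
  rewrite /M1 !mulrDl; apply: le_trans (ler_normD _ _) (lerD _ _).
    apply: le_trans (ler_normD _ _) (lerD _ _).
      by apply: norm_riesz (f2 h); rewrite ?mulr_ge0.
    apply: le_trans (norm_adjoint (FBl h) (F2 h) _ _) _; first exact: mulr_ge0.
    by rewrite mulrAC ler_wpM2r// ler_wpM2l.
  rewrite -mulrA; apply: sumM => i.
  rewrite mxE scale0r add0r normrZ -mulrA; apply: ler_pM => //.
  by apply: norm_riesz (g2 i h); rewrite ?mulr_ge0.
have DU : `|detaF (h, 0, 0)| <= 2 * M * M1 * `|h|.
  apply: le_trans (ler_normD _ _) _.
  apply: (@le_trans _ _ (M * `|h| * M1 + M * (M1 * `|h|))); last by lra.
  apply: lerD; first by apply: le_trans (F2 _ _) _; rewrite ler_wpM2l// mulr_ge0.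
  by apply: le_trans (F1 _) _; rewrite ler_wpM2l.
have DV i : `|detag i (h, 0, 0)| <= (2 * M * M1 + 2 * M * M * M) * `|h|.
  rewrite /detag /= mxE mulr0 addr0.
  apply: le_trans (ler_normD _ _) _.
  apply: (@le_trans _ _ ((M * `|h| * M1 + M * (M1 * `|h|)) + 2 * M * (M * `|h|) * M));
    last by lra.
  apply: lerD; last first.
    rewrite !normrM ger0_norm//; apply: ler_pM => //.
    by apply: ler_pM => //; rewrite ?mulr_ge0 ?ler_wpM2l.
  apply: le_trans (ler_normD _ _) (lerD _ _).
    apply: le_trans (ler_inner _ _) _; apply: ler_pM => //.
    by apply: norm_riesz (g2 i h); rewrite ?mulr_ge0.
  by apply: le_trans (ler_inner _ _) _; apply: ler_pM.
have E0 := enorm_ge0 etag.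
have h0 := normr_ge0 h; have eF0 := normr_ge0 etaF.
set M2 := 2 * M * M1 + 2 * M * M * M in DV.
have M20 : 0 <= M2 by rewrite addr_ge0 ?mulr_ge0.
apply: le_trans (ler_normD _ _) _.
apply: (@le_trans _ _ (`|etaF| * (2 * M * M1 * `|h|) +
  m%:R * (enorm etag * (M2 * `|h|)))).
  apply: lerD.
    by apply: le_trans (ler_inner _ _) _; rewrite ler_wpM2l.
  apply: le_trans (ler_norm_sum _ _ _) _.
  apply: (@le_trans _ _ (\sum_(i < m) (enorm etag * (M2 * `|h|)))).
    apply: ler_sum => i _; rewrite normrM; apply: ler_pM => //.
    exact: coord_le_enorm.
  by rewrite sumr_const card_ord mulr_natl.
rewrite /eta_const -/M1 -/M2.
have : 0 <= 2 * M * M1 * enorm etag * `|h| by rewrite !mulr_ge0.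
have : 0 <= m%:R * M2 * `|etaF| * `|h| by rewrite !mulr_ge0.
move: (m%:R) => n; lra.
Qed.

End EtaDerivative.

(** * Derivatives of b, p, phi(|F|^2) and of the inequality penalty *)

Section PenaltyDerivative.
Context (R : realType) (X H : hilbertType R) (m : nat).
Notation Z := (X * H * 'rV[R]_m)%type.
Context (F : X -> H) (g : 'I_m -> X -> R).
Context (gd : forall i y, differentiable (g i) y).
Context (Fd : forall y, differentiable F y).
Context (psi : 'rV[R]_m -> R) (D : 'rV[R]_m -> 'rV[R]_m -> R).
Context (psiD : C1_within (@orthant R m) psi D).
Context (D0 : forall (y : 'rV[R]_m) i, orthant y -> y 0 i = 0 ->
  D y (delta_mx 0 i) = 0).

Lemma gpos_orthant x : orthant (gpos g x).
Proof. by move=> i; rewrite mxE le_max lexx orbT. Qed.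

Lemma continuous_bounded_op (V W : normedModType R) (l : V -> W) :
  linear l -> continuous l -> bounded_op l.
Proof.
move=> ll lc; pose L : {linear V -> W} := HB.pack l (GRing.isLinear.Build _ _ _ _ l ll).
have Lc : continuous L by [].
by have [C C0 CP] := linear_lipschitz Lc; split=> //; exists C.
Qed.

Lemma norm_le_sum (u : 'rV[R]_m) : `|u| <= \sum_i `|u 0 i|.
Proof.
rewrite [leLHS]/Num.Def.normr /= mx_normrE; apply: bigmax_le.
  exact: sumr_ge0.
move=> [i j] _ /=; rewrite (ord1 i) (bigD1 j)//= lerDl.
exact: sumr_ge0.
Qed.

(** [gpos] is not differentiable at kinks; a Lipschitz bound is what the remainder of psi needs. *)
Lemma gpos_lipschitz x : exists2 C : R, 0 < C &
  \forall y \near x, `|gpos g y - gpos g x| <= C * `|y - x|.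
Proof.
have /choice[C CP] : forall i, exists C : R, 0 < C /\
    \forall y \near x, `|g i y - g i x| <= C * `|y - x|.
  by move=> i; have [C] := Fderiv_lipschitz (diff_Fderiv (gd i x)); exists C.
exists (1 + \sum_i C i).
  by rewrite ltr_pwDl// sumr_ge0// => i _; case: (CP i) => /ltW.
have := @filter_forall _ _ _ _ (nbhs_filter x) (fun i => (CP i).2).
apply: filterS => y yP; apply: le_trans (norm_le_sum _) _.
rewrite mulrDl mul1r mulr_suml ler_wpDl//; apply: ler_sum => i _.
apply: le_trans (yP i); rewrite !mxE.
have : forall a b : R, `|Num.max a 0 - Num.max b 0| <= `|a - b|.
  move=> a b; have h1 := ler_norm (a - b); have h2 := ler_norm (b - a).
  rewrite distrC in h2; move: h1 h2 (normr_ge0 (a - b)).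
  move: `|a - b| => t h1 h2 h3; rewrite ler_norml.
  by case: (leP a 0); case: (leP b 0) => b0 a0; apply/andP; split; lra.
exact.
Qed.

Definition db x (k : X) : R :=
  \sum_i D (gpos g x) (delta_mx 0 i) * 'd (g i) x k.

(* At a kink g_i(x) = 0 of max(g_i, 0) the partial derivative of psi vanishes. *)
Lemma Fderiv_bfun x : Fderiv (bfun g psi) x (db x).
Proof.
have [Dl Dc Dest _] := psiD (gpos_orthant x).
have Db := continuous_bounded_op Dl Dc.
pose a i := D (gpos g x) (delta_mx 0 i).
have Dg y : D (gpos g x) (gpos g y) = \sum_i a i * Num.max (g i y) 0.
  rewrite [in LHS](row_sum_delta (gpos g y)).
  transitivity (\sum_i (gpos g y 0 i *: D (gpos g x) (delta_mx 0 i))).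
    elim/big_rec2: _ => [|i s t _ <-]; first by rewrite (islin0 Dl).
    by rewrite (islinD Dl) (islinZ Dl).
  by apply: eq_bigr => i _; rewrite mxE mulrC.
(* Either g_i(x) <= 0 and the coefficient vanishes, or g_i > 0 near x and the max is g_i itself. *)
have ad i : Fderiv (fun y => a i * Num.max (g i y) 0) x (fun k => a i * 'd (g i) x k).
  have [gi0|gi0] := leP (g i x) 0.
    have -> : a i = 0 by apply: D0; [exact: gpos_orthant|rewrite mxE max_r].
    apply: Fderiv_eq (Fderiv_cst 0 x) => [|k]; last by rewrite mul0r.
    by near=> y; rewrite mul0r.
  have gF := diff_Fderiv (gd i x).
  have := Fderiv_mul (Fderiv_cst (a i) x) gF.
  apply: Fderiv_eq => [|k]; last by rewrite mul0r add0r.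
  have := Fderiv_continuous gF; move/cvgr_gt => /(_ _ gi0).
  by apply: filterS => y y0; rewrite max_l// ltW.
(* What remains after subtracting the linearization of psi at [gpos g x] is o(|gpos y - gpos x|),
   hence o(|y - x|). *)
have rest : Fderiv (fun y => bfun g psi y - D (gpos g x) (gpos g y)) x (fun=> 0).
  split=> [|e e0]; first by case: (Fderiv_cst (0 : R) x).
  have [C C0 CP] := gpos_lipschitz x.
  have e1 : 0 < e / C by rewrite divr_gt0.
  have gc : gpos g y @[y --> x] --> gpos g x.
    apply/cvgrPdist_le => e2 e20.
    have := near_norm_le x (divr_gt0 e20 C0).
    apply: filterS2 CP => y yP; rewrite ler_pdivlMr// mulrC => ye.
    by rewrite distrC; exact: le_trans yP ye.
  have := gc _ (Dest _ e1).
  apply: filterS2 CP => y yP /(_ (gpos_orthant y)) h.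
  rewrite subr0 (_ : _ - _ = psi (gpos g y) - psi (gpos g x) -
     D (gpos g x) (gpos g y - gpos g x)); last first.
    by rewrite (islinB Dl) /bfun; ring.
  apply: le_trans h _.
  have -> : e * `|y - x| = e / C * (C * `|y - x|) by field; rewrite gt_eqF.
  by rewrite ler_wpM2l ?(ltW e1).
have := Fderiv_add rest (Fderiv_sum ad).
apply: Fderiv_eq => [|k]; last by rewrite add0r.
by near=> y; rewrite Dg subrK.
Unshelve. all: by end_near. Qed.

Context (phi : R -> \bar R) (Dphi : R -> R -> R).
Context (phiH : phi_assumptions phi).
Context (phiD : C1_within (edom phi) (fun t => fine (phi t)) Dphi).

Lemma normsqr_near x (r : R) : `|F x| ^+ 2 < r ->
  \forall y \near x, `|F y| ^+ 2 < r.
Proof.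
have Fi := Fderiv_inner (diff_Fderiv (Fd x)) (diff_Fderiv (Fd x)).
have := Fderiv_continuous Fi; move/cvgr_lt => + xr.
rewrite inner_normE => /(_ _ xr).
by apply: filterS => y; rewrite inner_normE.
Qed.

(** Openness comes from the barrier alternative: in both cases [edom phi] is open relative to the
    half-line, which |F|^2 never leaves. *)
Lemma Omega_near x : Omega F g phi psi x -> \forall y \near x, Omega F g phi psi y.
Proof.
move=> [b0 phix].
have bc := Fderiv_continuous (Fderiv_bfun x).
have : \forall y \near x, 0 < bfun g psi y by move/cvgr_gt: bc => /(_ _ b0).
suff : \forall y \near x, (phi (`|F y| ^+ 2)%R < +oo)%E.
  by apply: filterS2 => y ? ?; split.
have xdom : edom phi (`|F x| ^+ 2) by split; rewrite ?exprn_ge0.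
have [[dE _]|[al [al0 dE _]]] := phi_barrier phiH.
  near=> y.
  have : edom phi (`|F y| ^+ 2) by rewrite dE /= in_itv/= andbT exprn_ge0.
  by case.
have xal : `|F x| ^+ 2 < al by move: xdom; rewrite dE /= in_itv/= => /andP[].
apply: filterS (normsqr_near xal) => y yal.
have : edom phi (`|F y| ^+ 2) by rewrite dE /= in_itv/= exprn_ge0.
by case.
Unshelve. all: by end_near. Qed.

Definition phiF (y : X) : R := fine (phi (`|F y| ^+ 2)%R).

Lemma Fderiv_phiF x : Omega F g phi psi x -> Fderiv phiF x
  (fun k => Dphi (`|F x| ^+ 2) 1 * (2 * inner (F x) ('d F x k))).
Proof.
move=> xO.
have xdom : edom phi (`|F x| ^+ 2) by case: xO => _ ?; split; rewrite ?exprn_ge0.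
have [Dl Dc Dest _] := phiD xdom.
have Fi : Fderiv (fun y => `|F y| ^+ 2) x (fun k => 2 * inner (F x) ('d F x k)).
  have := Fderiv_inner (diff_Fderiv (Fd x)) (diff_Fderiv (Fd x)).
  apply: Fderiv_eq => [|k]; last by rewrite innerC; ring.
  by near=> y; rewrite inner_normE.
have dom : \forall y \near x, edom phi (`|F y| ^+ 2).
  by apply: filterS (Omega_near xO) => y [_ ?]; split; rewrite ?exprn_ge0.
have := Fderiv_comp_within Fi dom (continuous_bounded_op Dl Dc) Dest.
apply: Fderiv_eq => [|k /=]; first by near=> y.
rewrite [RHS]mulrC -[RHS](islinZ Dl).
by congr (Dphi _ _); rewrite /GRing.scale/= mulr1.
Unshelve. all: by end_near. Qed.

Lemma Fderiv_enormsqr (w : Z) :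
  Fderiv (fun v : Z => 1 + enorm v.2 ^+ 2) w (fun k => 2 * dotr w.2 k.2).
Proof.
have := Fderiv_add (Fderiv_cst (1 : R) w)
  (Fderiv_sum (fun i => Fderiv_sqr (Fderiv_pM i w))).
apply: Fderiv_eq => [|k]; first by near=> v; rewrite enormE.
by rewrite add0r /dotr mulr_sumr; apply: eq_bigr => i _; rewrite mulrA.
Unshelve. all: by end_near. Qed.

Lemma enorm1_gt0 (mu : 'rV[R]_m) : 0 < 1 + enorm mu ^+ 2.
Proof. by rewrite ltr_pwDl// exprn_ge0// enorm_ge0. Qed.

Definition dp x (mu : 'rV[R]_m) (k : Z) : R :=
  (db x k.1.1 - 2 * pfun g psi x mu * dotr mu k.2) / (1 + enorm mu ^+ 2).

Lemma Fderiv_pfun x lam mu :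
  Fderiv (fun w : Z => pfun g psi w.1.1 w.2) (x, lam, mu) (dp x mu).
Proof.
have m0 := lt0r_neq0 (enorm1_gt0 mu).
have := Fderiv_mul (@Fderiv_compX _ _ _ _ _ _ (x, lam, mu) _ (Fderiv_bfun x))
  (@Fderiv_inv _ _ _ (x, lam, mu) _ m0 (Fderiv_enormsqr (x, lam, mu))).
apply: Fderiv_eq => [|k]; first by near=> w.
by rewrite /dp /pfun/=; field.
Unshelve. all: by end_near. Qed.

(** Completing the square with q = (p / c) (max(s + c y / p, 0) - s). The max then occurs only as a
    squared positive part, which is continuously differentiable. *)
Lemma penaltyE (p c y s : R) : 0 < p -> 0 < c ->
  let q := Num.max y (- (p / c) * s) in
  s * q + c / (2 * p) * q ^+ 2 =
  p * (2 * c)^-1 * (Num.max (s + c * (y * p^-1)) 0 ^+ 2 - s ^+ 2).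
Proof.
move=> p0 c0 /=.
have p1 := lt0r_neq0 p0; have c1 := lt0r_neq0 c0.
have eq1 : y - - (p / c) * s = p / c * (s + c * (y * p^-1)).
  by field; rewrite ?c1 ?p1.
have pc : 0 < p / c by rewrite divr_gt0.
have [h|h] := leP y (- (p / c) * s).
  rewrite max_r; first by field; rewrite ?c1 ?p1.
  by move: h; rewrite -subr_le0 eq1 pmulr_rle0.
rewrite max_l; first by field; rewrite ?c1 ?p1.
by move: h; rewrite -subr_gt0 eq1 pmulr_rgt0// => /ltW.
Qed.

Lemma max_penaltyE (p c y s : R) : 0 < p -> 0 < c ->
  let q := Num.max y (- (p / c) * s) in
  Num.max (s + c * (y * p^-1)) 0 = s + c / p * q.
Proof.
move=> p0 c0 /=.
have p1 := lt0r_neq0 p0; have c1 := lt0r_neq0 c0.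
have eq1 : y - - (p / c) * s = p / c * (s + c * (y * p^-1)).
  by field; rewrite ?c1 ?p1.
have pc : 0 < p / c by rewrite divr_gt0.
have [h|h] := leP y (- (p / c) * s).
  rewrite max_r; first by field; rewrite ?c1 ?p1.
  by move: h; rewrite -subr_le0 eq1 pmulr_rle0.
rewrite max_l; first by field.
by move: h; rewrite -subr_gt0 eq1 pmulr_rgt0// => /ltW.
Qed.

(** Either q = y, or q = - p s / c and the first factor vanishes. *)
Lemma penalty_compl (p c y s : R) : 0 < p -> 0 < c ->
  let q := Num.max y (- (p / c) * s) in
  (s + c / p * q) * (q - y) = 0.
Proof.
move=> p0 c0 /=.
have p1 := lt0r_neq0 p0; have c1 := lt0r_neq0 c0.
have [h|h] := leP y (- (p / c) * s); last by rewrite subrr mulr0.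
by field; rewrite c1.
Qed.

Definition dpen c x (mu : 'rV[R]_m) (k : Z) : R :=
  let p := pfun g psi x mu in
  \sum_i ((mu 0 i + c / p * qfun g psi x mu c 0 i) * 'd (g i) x k.1.1
    - c / (2 * p ^+ 2) * qfun g psi x mu c 0 i ^+ 2 * dp x mu k
    + qfun g psi x mu c 0 i * k.2 0 i).

Lemma pfun_gt0 x mu : 0 < bfun g psi x -> 0 < pfun g psi x mu.
Proof. by move=> b0; rewrite divr_gt0 ?enorm1_gt0. Qed.

(* The penalty is a minimum over all q with q_i >= g_i, hence the envelope form
   of its derivative with respect to p and mu. *)
Lemma Fderiv_pen c x lam mu : 0 < c -> 0 < bfun g psi x ->
  Fderiv (fun w : Z => dotr w.2 (qfun g psi w.1.1 w.2 c) +
    c / (2 * pfun g psi w.1.1 w.2) * enorm (qfun g psi w.1.1 w.2 c) ^+ 2)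
    (x, lam, mu) (dpen c x mu).
Proof.
move=> c0 b0; have p0 := pfun_gt0 mu b0.
have pF := Fderiv_pfun x lam mu.
set w0 := (x, lam, mu).
have gF i := @Fderiv_compX _ _ _ _ _ _ w0 _ (diff_Fderiv (gd i x)).
have p1 := lt0r_neq0 p0; have c1 := lt0r_neq0 c0.
have pV := @Fderiv_inv _ _ (fun w : Z => pfun g psi w.1.1 w.2) w0 _ p1 pF.
have mF i := Fderiv_add (Fderiv_pM i w0)
  (Fderiv_mul (Fderiv_cst c w0) (Fderiv_mul (gF i) pV)).
have nF i := Fderiv_add (Fderiv_maxr0_sqr (mF i))
  (Fderiv_mul (Fderiv_cst (-1 : R) w0) (Fderiv_sqr (Fderiv_pM i w0))).
have := Fderiv_sum (fun i => Fderiv_mul (Fderiv_mul pF (Fderiv_cst (2 * c)^-1 w0)) (nF i)).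
apply: Fderiv_eq => [|k].
  have := @Fderiv_continuous _ _ _ _ w0 _ (Fderiv_compX (w := w0) (Fderiv_bfun x)).
  move/cvgr_gt => /(_ _ b0); apply: filterS => w wb0.
  have pw0 := pfun_gt0 w.2 wb0.
  rewrite /dotr enormE mulr_sumr -big_split; apply: eq_bigr => i _ /=.
  by rewrite mulN1r mxE -(penaltyE _ _ pw0 c0).
apply: eq_bigr => i _; rewrite /= !mul0r !add0r mulr0 addr0 mulN1r.
rewrite (max_penaltyE _ _ p0 c0).
have qE : qfun g psi x mu c 0 i =
  Num.max (g i x) (- (pfun g psi x mu / c) * mu 0 i) by rewrite mxE.
have := penalty_compl (g i x) (mu 0 i) p0 c0; rewrite -qE /=.
move: (qfun g psi x mu c 0 i) (dp x mu k) ('d (g i) x k.1.1) => q t d compl.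
move: (pfun g psi x mu) p1 compl => p p1 compl.
(* Differentiating the smooth form leaves g_i in the coefficient of dp; replacing it by q_i changes
   the sum by dp / p times the complementarity product, which is 0. *)
rewrite -[RHS]addr0 -[X in _ = _ + X](mul0r (t / p)) -compl.
by field; rewrite p1 c1.
Qed.

End PenaltyDerivative.

(** * The derivative of the augmented Lagrangian in the two test directions *)

Section TotalDerivative.
Context (R : realType) (X H : hilbertType R) (m : nat).
Notation Z := (X * H * 'rV[R]_m)%type.
Context (f : X -> R) (F : X -> H) (g : 'I_m -> X -> R).
Context (fd : forall y, differentiable f y).
Context (gd : forall i y, differentiable (g i) y).
Context (Fd : forall y, differentiable F y).
Context (psi : 'rV[R]_m -> R) (D : 'rV[R]_m -> 'rV[R]_m -> R).
Context (psiD : C1_within (@orthant R m) psi D).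
Context (D0 : forall (y : 'rV[R]_m) i, orthant y -> y 0 i = 0 ->
  D y (delta_mx 0 i) = 0).
Context (phi : R -> \bar R) (Dphi : R -> R -> R).
Context (phiH : phi_assumptions phi).
Context (phiD : C1_within (edom phi) (fun t => fine (phi t)) Dphi).

Context (x : X) (lam : H) (mu : 'rV[R]_m) (c : R).
Context (Bf : X -> X -> R) (BF : X -> X -> H) (Bg : 'I_m -> X -> X -> R).
Context (fB : is_diff2 f x Bf) (FB : is_diff2 F x BF).
Context (gB : forall i, is_diff2 (g i) x (Bg i)).
Context (xO : Omega F g phi psi x) (c0 : 0 < c).
Notation w0 := ((x, lam, mu) : Z).
Notation p := (pfun g psi x mu).
Notation q := (qfun g psi x mu c).
Notation G := (grad_lagr f F g x lam mu).
Notation U := (etaF f F g x lam mu).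
Notation v := (etag f F g x lam mu).
Notation De := (deta f F g x lam mu Bf BF Bg).
Notation phi' := (Dphi (`|F x| ^+ 2) 1).
Notation delta := (norm_grad_auglagr f F g phi psi c w0).

Definition dauglagr (k : Z) : R :=
  'd f x k.1.1 + (inner k.1.2 (F x) + inner lam ('d F x k.1.1)) +
  c / 2 * (2 * inner lam k.1.2 * phiF F phi x +
    (1 + `|lam| ^+ 2) * (phi' * (2 * inner (F x) ('d F x k.1.1)))) +
  dpen g psi D c x mu k + De k.

Lemma Fderiv_auglagr :
  Fderiv (fun w : Z => fine (auglagr f F g phi psi w.1.1 w.1.2 w.2 c)) w0 dauglagr.
Proof.
have b0 := xO.1.
have fF := @Fderiv_compX _ _ _ _ _ _ w0 _ (diff_Fderiv (fd x)).
have FF := @Fderiv_compX _ _ _ _ _ _ w0 _ (diff_Fderiv (Fd x)).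
have lF := Fderiv_inner (Fderiv_pH w0) FF.
have l2 := Fderiv_add (Fderiv_cst (1 : R) w0)
  (Fderiv_inner (Fderiv_pH w0) (Fderiv_pH w0)).
have pF := @Fderiv_compX _ _ _ _ _ _ w0 _ (Fderiv_phiF gd Fd psiD D0 phiH phiD xO).
have cF := Fderiv_mul (Fderiv_cst (c / 2) w0) (Fderiv_mul l2 pF).
have := Fderiv_add (Fderiv_add (Fderiv_add (Fderiv_add fF lF) cF)
   (Fderiv_pen gd psiD D0 lam mu c0 b0)) (Fderiv_eta fd gd Fd lam mu fB FB gB).
apply: Fderiv_eq => [|k].
  (* Near a point of the open set Omega the value +oo does not occur, so the finite formula may be
     differentiated. *)
  have : \forall w \near w0, Omega F g phi psi w.1.1.
    exact: Fderiv_continuous (Fderiv_pX w0) _ (Omega_near gd Fd psiD D0 phiH xO).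
  apply: filterS => w wO; rewrite /auglagr ifT /=; last exact/asboolP.
  by rewrite inner_normE -/(phiF _ _ _) !addrA !mulrA.
rewrite /dauglagr; congr (_ + _ + _ + _).
by rewrite /= mul0r !add0r (innerC _ lam) inner_normE; ring.
Qed.

(** Riesz representation and Cauchy-Schwarz in the Hilbert product; each choice of k gives one lower
    bound on the gradient norm. *)
Lemma dauglagr_le k : dauglagr k <= delta * Num.sqrt (prod_inner k k).
Proof.
have [_ dE] := Fderiv_diff Fderiv_auglagr.
have [[Dl [C C_gt0 DC]] _] := Fderiv_auglagr.
rewrite -dE -(@riesz_prodP _ _ _ _ _ C); last 2 first.
- by rewrite dE.
- by rewrite dE.
exact: le_trans (ler_norm _) (ler_prod_inner _ _).
Qed.

(** The last bracket is quadratic in (U, v) and coercive, whereas all other terms are linear in (U,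
    v); this is what makes the residuals estimable. *)
Lemma dauglagr_dual : dauglagr (0, U, v) =
  inner U (F x) + c * phiF F phi x * inner lam U + dotr q v
  + c / p * enorm q ^+ 2 * (dotr mu v / (1 + enorm mu ^+ 2))
  + (`|Qdir F g x U v| ^+ 2 + \sum_i g i x ^+ 2 * v 0 i ^+ 2).
Proof.
rewrite /dauglagr (deta_dual fd gd Fd lam mu fB FB gB) /= !linear0 !inner0r.
rewrite add0r addr0 !mulr0 addr0; congr (_ + _); rewrite -!addrA; congr (_ + _).
congr (_ + _); first by field.
have p1 := lt0r_neq0 (pfun_gt0 mu xO.1).
have m0 := lt0r_neq0 (enorm1_gt0 mu).
have dpE : dp g psi D x mu (0, U, v) = - (2 * p * dotr mu v) / (1 + enorm mu ^+ 2).
  rewrite /dp/= /db big1 ?sub0r// => i _.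
  by rewrite linear0 mulr0.
rewrite /dpen /= dpE (enormE q); set t := dotr mu v.
rewrite -[RHS]/((\sum_i q 0 i * v 0 i) + _) mulr_sumr [X in _ = _ + X]mulr_suml -big_split.
apply: eq_bigr => i _ /=; rewrite linear0 mulr0 add0r addrC.
by congr (_ + _); field; rewrite m0 p1.
Qed.

(** Together with [zg], the coefficients of c in the effective multipliers: the penalties change
    lambda to lambda + c zF and mu to mu + c zg in the x-derivative. *)
Definition zF : H := ((1 + `|lam| ^+ 2) * phi') *: F x.
Definition zg : 'rV[R]_m := p^-1 *: q.
Notation h := (Qdir F g x zF zg).

Lemma inner_Qdir l (s : 'rV[R]_m) k : inner (Qdir F g x l s) k =
  inner l ('d F x k) + \sum_i s 0 i * 'd (g i) x k.
Proof.
rewrite /Qdir innerDl inner_suml bounded_inner_adjoint.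
  by congr (_ + _); apply: eq_bigr => i _; rewrite innerZl gradP.
exact: diff_bounded_op.
Qed.

(** By adjointness h tests G through DF and the gradients of the g_i, which are the ingredients of U
    and v. The subtracted sum is the part g_i^2 mu_i of v that does not come from G. *)
Lemma inner_grad_lagr_Qdir : inner G h =
  inner zF U + dotr zg v - \sum_i zg 0 i * (g i x ^+ 2 * mu 0 i).
Proof.
rewrite innerC inner_Qdir -addrA; congr (_ + _).
rewrite /dotr -sumrB; apply: eq_bigr => i _.
by rewrite [v 0 i]mxE gradP//; ring.
Qed.

(** The part of the x-derivative that is c times the Riesz vector h contributes c |h|^2 when tested
    against h. *)
Lemma dauglagr_primal : dauglagr (h, 0, 0) =
  inner G h + c * `|h| ^+ 2
  - c / (2 * p ^+ 2) * enorm q ^+ 2 * (db g D x h / (1 + enorm mu ^+ 2))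
  + De (h, 0, 0).
Proof.
rewrite /dauglagr; congr (_ + _).
rewrite (inner_grad_lagr fd gd Fd) /= inner0l inner0r add0r mulr0 mul0r add0r.
rewrite -(inner_normE h) [inner h h]inner_Qdir.
have p1 := lt0r_neq0 (pfun_gt0 mu xO.1).
have dpenE (k : Z) : k.1.1 = h -> k.2 = 0 -> dpen g psi D c x mu k =
  \sum_i mu 0 i * 'd (g i) x h + c * (\sum_i zg 0 i * 'd (g i) x h) -
  c / (2 * p ^+ 2) * enorm q ^+ 2 * (db g D x h / (1 + enorm mu ^+ 2)).
  move=> kh k0; have dpE : dp g psi D x mu k = db g D x h / (1 + enorm mu ^+ 2).
    by rewrite /dp kh k0 (dotrC mu) -[X in dotr X](scale0r 0) dotrZl mul0r mulr0 subr0.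
  rewrite /dpen dpE kh k0 (enormE q); set t := _ / (1 + _).
  rewrite mulr_sumr [X in _ = _ - X * _]mulr_sumr [X in _ = _ - X]mulr_suml.
  rewrite -sumrN -!big_split/=; apply: eq_bigr => i _.
  by rewrite !mxE mulr0 addr0; field; rewrite p1.
rewrite (dpenE (h, 0, 0) erefl erefl).
by rewrite [inner zF _]innerZl; move: (c / _ * _ * _) => t; field.
Qed.


Lemma norm_Qdir_le (M : R) l (s : 'rV[R]_m) : 0 <= M ->
  (forall k, `|'d F x k| <= M * `|k|) -> (forall i k, `|'d (g i) x k| <= M * `|k|) ->
  `|Qdir F g x l s| <= M * (1 + m%:R) * (`|l| + enorm s).
Proof.
move=> M0 F1 g1; apply: le_trans (ler_normD _ _) _.
apply: (@le_trans _ _ (M * `|l| + m%:R * (enorm s * M))); last first.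
  have := enorm_ge0 s; have := normr_ge0 l; have : 0 <= m%:R :> R by [].
  move: (m%:R) (`|l|) (enorm s) => n u t n0 u0 t0.
  have : 0 <= M * n * u by rewrite !mulr_ge0.
  have : 0 <= M * t by rewrite !mulr_ge0.
  lra.
apply: lerD.
  apply: norm_adjoint => // b u t; by rewrite linearP.
apply: le_trans (ler_norm_sum _ _ _) _.
apply: (@le_trans _ _ (\sum_(i < m) (enorm s * M))).
  apply: ler_sum => i _; rewrite normrZ; apply: ler_pM => //.
    exact: coord_le_enorm.
  exact: norm_grad.
by rewrite sumr_const card_ord mulr_natl.
Qed.

Lemma delta_ge0 : 0 <= delta.
Proof. exact: sqrtr_ge0. Qed.

Lemma eta_const_ge0 (M : R) : 0 <= M -> 0 <= eta_const m M.
Proof. by move=> M0; rewrite /eta_const !(addr_ge0, mulr_ge0). Qed.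

Lemma mulr_le_cancel (a n B : R) : 0 <= n -> 0 <= B -> a * n ^+ 2 <= n * B -> a * n <= B.
Proof.
rewrite le_eqVlt => /predU1P[<- B0 _|n0 _]; first by rewrite mulr0.
by rewrite expr2 mulrA mulrC ler_pM2l.
Qed.

(** * Estimates at one point with a single bound M on all data *)

Context (a M : R).
Context (a0 : 0 < a) (M1 : 1 <= M).
Context (coer : forall l (s : 'rV[R]_m), a * (`|l| ^+ 2 + enorm s ^+ 2) <=
  `|Qdir F g x l s| ^+ 2 + \sum_i g i x ^+ 2 * s 0 i ^+ 2).
Context (lamM : `|lam| <= M) (muM : enorm mu <= M) (gM : forall i, `|g i x| <= M).
Context (f1 : forall k, `|'d f x k| <= M * `|k|).
Context (F1 : forall k, `|'d F x k| <= M * `|k|).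
Context (g1 : forall i k, `|'d (g i) x k| <= M * `|k|).
Context (f2 : forall k l, `|Bf k l| <= M * `|k| * `|l|).
Context (F2 : forall k l, `|BF k l| <= M * `|k| * `|l|).
Context (g2 : forall i k l, `|Bg i k l| <= M * `|k| * `|l|).
Context (pM : M^-1 <= p) (Mp : p <= M) (phi'M : M^-1 <= phi').
Context (phi_ge : 0 <= phiF F phi x) (phi_le : phiF F phi x <= M * `|F x| ^+ 2).
Context (qM : enorm q <= M) (dbM : forall k, `|db g D x k| <= M * `|k|).

Notation n0 := (`|U| + enorm v).
Notation T := (delta + `|F x| + enorm q + c * (`|F x| ^+ 2 + enorm q ^+ 2)).

Let M0 : 0 < M. Proof. exact: lt_le_trans ltr01 M1. Qed.
Let MM1 : 1 <= M * M. Proof. by rewrite -(mulr1 1) ler_pM. Qed.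
Let p0 : 0 < p. Proof. exact: pfun_gt0 xO.1. Qed.
Let pVM : p^-1 <= M.
Proof. by rewrite -[leRHS]invrK lef_pV2// posrE invr_gt0. Qed.

(** In [dauglagr_dual] the coercive bracket is at least a (|U|^2 + |v|^2), and every other term is
    at most n0 times a summand of T, up to M^2. One factor n0 is then divided out. *)
Lemma residual_le : a / 2 * n0 <= M * M * T.
Proof.
have U0 := normr_ge0 U; have v0 := enorm_ge0 v; have q0 := enorm_ge0 q.
have F0 := normr_ge0 (F x); have d0 := delta_ge0.
have n00 : 0 <= n0 by exact: addr_ge0.
have h1 : - (n0 * `|F x|) <= inner U (F x).
  apply: lerNnormlW; apply: le_trans (ler_inner _ _) _.
  by rewrite ler_wpM2r// lerDl.
have h2 : - (c * (M * `|F x| ^+ 2) * (M * n0)) <= c * phiF F phi x * inner lam U.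
  apply: lerNnormlW; rewrite normrM; apply: ler_pM => //.
    by rewrite ger0_norm ?mulr_ge0 ?(ltW c0)// ler_wpM2l ?(ltW c0).
  apply: le_trans (ler_inner _ _) _; apply: ler_pM => //.
  by rewrite lerDl.
have h3 : - (enorm q * n0) <= dotr q v.
  apply: lerNnormlW; apply: le_trans (ler_dotr _ _) _.
  by rewrite ler_wpM2l// lerDr.
have h4 : - (c * M * enorm q ^+ 2 * (M * n0)) <=
    c / p * enorm q ^+ 2 * (dotr mu v / (1 + enorm mu ^+ 2)).
  apply: lerNnormlW; rewrite normrM; apply: ler_pM => //.
    rewrite ger0_norm ?mulr_ge0 ?exprn_ge0 ?invr_ge0 ?(ltW c0) ?(ltW p0)//.
    by rewrite ler_wpM2r ?exprn_ge0// ler_wpM2l ?(ltW c0).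
  rewrite normrM normfV [X in _ / X]gtr0_norm ?enorm1_gt0//.
  rewrite ler_pdivrMr ?enorm1_gt0//.
  apply: (@le_trans _ _ (M * n0)).
    apply: le_trans (ler_dotr _ _) _; apply: ler_pM => //; first exact: enorm_ge0.
    by rewrite lerDr.
  by rewrite ler_peMr ?mulr_ge0 ?(ltW M0)// lerDl exprn_ge0// enorm_ge0.
have h5 := coer U v.
have h6 : dauglagr (0, U, v) <= delta * n0.
  apply: le_trans (dauglagr_le _) _; rewrite ler_wpM2l//.
  rewrite -(@ler_pXn2r _ 2) ?nnegrE ?sqrtr_ge0// sqr_sqrtr ?prod_inner_ge0//.
  rewrite /prod_inner /= inner0l add0r inner_normE -enorm_sqr.
  have : 0 <= `|U| * enorm v by rewrite mulr_ge0.
  by move: (`|U|) (enorm v) => u t; nra.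
rewrite dauglagr_dual in h6.
apply: mulr_le_cancel => //.
  by rewrite !mulr_ge0 ?(ltW M0)// !addr_ge0// mulr_ge0 ?(ltW c0)// addr_ge0 ?exprn_ge0.
have h7 : a / 2 * n0 ^+ 2 <= a * (`|U| ^+ 2 + enorm v ^+ 2).
  have := mulr_ge0 (ltW a0) (sqr_ge0 (`|U| - enorm v)).
  by move: (`|U|) (enorm v) => u t; nra.
have h8 : delta + `|F x| + enorm q <= M * M * (delta + `|F x| + enorm q).
  by rewrite ler_peMl// !addr_ge0.
have h9 := ler_wpM2l n00 h8.
move: h1 h2 h3 h4 h5 h6 h7 h9.
move: (inner U (F x)) (c * phiF F phi x * inner lam U) (dotr q v) => t1 t2 t3.
move: (c / p * _ * _) (`|Qdir F g x U v| ^+ 2) (\sum_i _) (a * _) (a / 2 * _) => t4 t5 t6 t7 t8.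
move: n0 delta (`|F x|) (enorm q) => n d u t; lra.
Qed.

Notation nz := (`|zF| + enorm zg).
(** [C1] is the factor in n0 <= C1 T from [residual_le], and [M2] bounds |w(l, s)| per unit of |l| +
    |s|. In the prefactor, 2 / a undoes the coercivity constant and M undoes |z| >= (|F| + |q|) /
    M. *)
Definition core_const : R := let C1 := 2 * (M * M) / a in
  let M2 := M * (1 + m%:R) in
  2 * M / a * (M2 + (1 + eta_const m M * M2) * C1 + 2 * m%:R * (M * M) + M * M * M * M2).

(** Coercivity at z turns c |h|^2 into c a |z|^2 minus the terms c g_i^2 z_i^2; everything else is
    at most |z| times a quantity controlled by T, so dividing by |z| leaves a bound linear in c
    |z|. *)
Lemma core_ineq : c * (`|F x| + enorm q) <= core_const * T.
Proof.
have U0 := normr_ge0 U; have v0 := enorm_ge0 v; have q0 := enorm_ge0 q.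
have F0 := normr_ge0 (F x); have d0 := delta_ge0.
have z0 := normr_ge0 zF; have zg0 := enorm_ge0 zg.
have nz0 : 0 <= nz by exact: addr_ge0.
have n00 : 0 <= n0 by exact: addr_ge0.
have h0 := normr_ge0 h.
set M2 := M * (1 + m%:R).
have M20 : 0 <= M2 by rewrite mulr_ge0 ?(ltW M0)// addr_ge0.
have hM2 : `|h| <= M2 * nz by apply: norm_Qdir_le => //; exact: ltW.
have T0 : 0 <= T.
  by rewrite !addr_ge0// mulr_ge0 ?(ltW c0)// addr_ge0 ?exprn_ge0.
have nzF : M^-1 * `|F x| <= `|zF|.
  have phi'0 : 0 <= phi' by apply: le_trans phi'M; rewrite invr_ge0 ltW.
  rewrite normrZ ler_wpM2r// ger0_norm ?mulr_ge0 ?addr_ge0 ?exprn_ge0//.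
  by apply: le_trans phi'M _; rewrite ler_peMl ?lerDl ?exprn_ge0.
have nzg : M^-1 * enorm q <= enorm zg.
  rewrite enormZ gtr0_norm ?invr_gt0// ler_wpM2r//.
  by rewrite lef_pV2.
have n0T : n0 <= 2 * (M * M) / a * T.
  have := residual_le; have -> : 2 * (M * M) / a * T = (M * M * T) / (a / 2).
    by field; rewrite gt_eqF.
  by rewrite ler_pdivlMr ?divr_gt0// mulrC.
have h1 : inner zF U + dotr zg v >= - (nz * n0).
  apply: lerNnormlW; apply: le_trans (ler_normD _ _) _.
  have := ler_inner zF U; have := ler_dotr zg v.
  have : 0 <= `|zF| * enorm v by rewrite mulr_ge0.
  have : 0 <= enorm zg * `|U| by rewrite mulr_ge0.
  lra.
have h2 : `|De (h, 0, 0)| <= eta_const m M * n0 * `|h|.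
  apply: (deta_primal_le fd gd Fd fB FB gB) => //; first exact: ltW.
  by move=> i; apply: le_trans (coord_le_enorm _ _) muM.
have h3 := coer zF zg.
have h4 : dauglagr (h, 0, 0) <= delta * `|h|.
  apply: le_trans (dauglagr_le _) _; rewrite ler_wpM2l//.
  rewrite /prod_inner /= inner0l addr0 (_ : dotr 0 0 = 0) ?addr0; last first.
    by rewrite -(scale0r 0) dotrZl mul0r.
  by rewrite inner_normE sqrtr_sqr normr_id.
rewrite dauglagr_primal inner_grad_lagr_Qdir in h4.
have h5 : c / (2 * p ^+ 2) * enorm q ^+ 2 * (db g D x h / (1 + enorm mu ^+ 2)) <=
    c * (M * M) * enorm q ^+ 2 * (M * `|h|).
  apply: le_trans (ler_norm _) _; rewrite normrM; apply: ler_pM => //.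
    have pp : 0 <= c / (2 * p ^+ 2).
      by rewrite divr_ge0 ?(ltW c0)// mulr_ge0// exprn_ge0// ltW.
    rewrite ger0_norm; last by apply: mulr_ge0 => //; rewrite exprn_ge0.
    rewrite ler_wpM2r ?exprn_ge0// ler_wpM2l ?(ltW c0)//.
    apply: (@le_trans _ _ (p^-1 * p^-1)).
      have : 0 <= p^-1 * p^-1 by rewrite mulr_ge0 ?invr_ge0 ?(ltW p0).
      by rewrite expr2 !invfM; lra.
    by rewrite ler_pM ?invr_ge0 ?(ltW p0).
  rewrite normrM normfV [X in _ / X]gtr0_norm ?enorm1_gt0//.
  rewrite ler_pdivrMr ?enorm1_gt0//.
  apply: le_trans (dbM _) _.
  by rewrite ler_peMr ?mulr_ge0 ?(ltW M0)// lerDl exprn_ge0// enorm_ge0.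
(* The loss from coercivity and the g_i^2 mu_i terms from grad L are estimated only in
   combination. *)
have h6 : \sum_i zg 0 i * (g i x ^+ 2 * mu 0 i) +
    c * (\sum_i g i x ^+ 2 * zg 0 i ^+ 2) <=
    nz * (m%:R * (M * M * enorm q + c * (M * M) * enorm q ^+ 2)).
  rewrite mulr_sumr -big_split /=.
  apply: (@le_trans _ _ (\sum_(i < m) (nz * (M * M * enorm q + c * (M * M) * enorm q ^+ 2))));
    last by rewrite sumr_const card_ord -[leLHS]mulr_natl mulrCA.
  apply: ler_sum => i _.
  have compl : (mu 0 i + c * zg 0 i) * (q 0 i - g i x) = 0.
    have := penalty_compl (g i x) (mu 0 i) p0 c0.
    by rewrite [zg 0 i]mxE [q 0 i]mxE mulrA.
  have -> : zg 0 i * (g i x ^+ 2 * mu 0 i) + c * (g i x ^+ 2 * zg 0 i ^+ 2) =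
      zg 0 i * (q 0 i ^+ 2 * (mu 0 i + c * zg 0 i)).
    transitivity (zg 0 i * (g i x ^+ 2 * (mu 0 i + c * zg 0 i))); first by ring.
    apply/eqP; rewrite -subr_eq0; apply/eqP.
    (* The difference of the two sides is a multiple of q_i^2 - g_i^2 times mu_i + c z_i, hence of
       the complementarity product. *)
    transitivity (- zg 0 i * (q 0 i + g i x) * ((mu 0 i + c * zg 0 i) * (q 0 i - g i x))).
      by ring.
    by rewrite compl mulr0.
  apply: le_trans (ler_norm _) _; rewrite normrM; apply: ler_pM => //.
    by apply: le_trans (coord_le_enorm _ _) _; rewrite lerDr.
  have qi := coord_le_enorm q i.
  have zi : `|zg 0 i| <= M * enorm q.
    by rewrite mxE normrM ger0_norm ?invr_ge0 ?(ltW p0)// ler_pM ?invr_ge0 ?(ltW p0).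
  have mi : `|mu 0 i| <= M by apply: le_trans (coord_le_enorm _ _) muM.
  have si : `|mu 0 i + c * zg 0 i| <= M + c * (M * enorm q).
    apply: le_trans (ler_normD _ _) (lerD _ _) => //.
    by rewrite normrM ger0_norm ?(ltW c0)// ler_wpM2l ?(ltW c0).
  rewrite normrM normrX.
  apply: (@le_trans _ _ (M * enorm q * (M + c * (M * enorm q)))).
    apply: ler_pM => //.
    by rewrite expr2; apply: ler_pM => //; apply: le_trans qi qM.
  by rewrite le_eqVlt; apply/orP; left; apply/eqP; ring.
set E := eta_const m M.
have E0 : 0 <= E by exact: eta_const_ge0 (ltW M0).
set C1 := 2 * (M * M) / a in n0T.
have C10 : 0 <= C1 by rewrite divr_ge0 ?(ltW a0)// !mulr_ge0 ?(ltW M0).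
pose B := delta * M2 + n0 + m%:R * (M * M * enorm q + c * (M * M) * enorm q ^+ 2) +
  c * (M * M) * enorm q ^+ 2 * (M * M2) + E * n0 * M2.
have cq0 : 0 <= c * enorm q ^+ 2 by rewrite mulr_ge0 ?exprn_ge0 ?(ltW c0).
have B0 : 0 <= B.
  by rewrite /B !addr_ge0// ?mulr_ge0// ?addr_ge0// ?mulr_ge0// ?exprn_ge0 ?(ltW c0) ?(ltW M0).
have hB : c * a / 2 * nz ^+ 2 <= nz * B.
  have k1 : a / 2 * nz ^+ 2 <= a * (`|zF| ^+ 2 + enorm zg ^+ 2).
    have := mulr_ge0 (ltW a0) (sqr_ge0 (`|zF| - enorm zg)).
    by move: (`|zF|) (enorm zg) => u t; nra.
  have k2 := ler_wpM2l (ltW c0) (le_trans k1 h3).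
  have k3 := ler_wpM2l d0 hM2.
  have MMM0 : 0 <= M * M * M by rewrite !mulr_ge0 ?(ltW M0).
  have k4 := ler_wpM2l (mulr_ge0 MMM0 cq0) hM2.
  have k5 := ler_wpM2l (mulr_ge0 E0 n00) hM2.
  have k6 : - (E * n0 * `|h|) <= De (h, 0, 0) by exact: lerNnormlW.
  rewrite /B; move: h1 h4 h5 h6 k2 k3 k4 k5 k6.
  move: (_ / (2 * p ^+ 2) * _ * _) (De _) => t1 t2.
  move: (\sum_i zg 0 i * (g i x ^+ 2 * mu 0 i)) (\sum_i g i x ^+ 2 * zg 0 i ^+ 2).
  move=> t3 t4; move: (inner zF U) (dotr zg v) => t5 t6.
  move: nz n0 delta (`|h|) (enorm q) (m%:R) => Nz N d u t n; lra.
have {}hB : c * a / 2 * nz <= B by exact: mulr_le_cancel hB.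
(* n0 is replaced by its bound in terms of T; the other terms are multiples of delta, |q| and c
   |q|^2, each at most T. *)
have BT : B <= (M2 + (1 + E * M2) * C1 + 2 * m%:R * (M * M) + M * M * M * M2) * T.
  have dT : delta <= T.
    by rewrite -!addrA lerDl !addr_ge0// mulr_ge0 ?(ltW c0)// addr_ge0 ?exprn_ge0.
  have cF0 : 0 <= c * `|F x| ^+ 2 by rewrite mulr_ge0 ?exprn_ge0 ?(ltW c0).
  have qT : enorm q + c * enorm q ^+ 2 <= T by rewrite mulrDr; lra.
  have cqT : c * enorm q ^+ 2 <= T by apply: le_trans qT; rewrite lerDr.
  have MM0 : 0 <= M * M by rewrite mulr_ge0 ?(ltW M0).
  have k1 := ler_wpM2l M20 dT.
  have EM0 : 0 <= 1 + E * M2 by rewrite addr_ge0// mulr_ge0.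
  have k2 := ler_wpM2l EM0 n0T.
  have mMM0 : 0 <= m%:R * (M * M) by rewrite mulr_ge0.
  have k3 := ler_wpM2l mMM0 qT.
  have MMMM0 : 0 <= M * M * M * M2 by rewrite !mulr_ge0 ?(ltW M0).
  have k4 := ler_wpM2l MMMM0 cqT.
  have k5 := mulr_ge0 mMM0 T0.
  rewrite /B; move: k1 k2 k3 k4 k5; move: T n0 delta (enorm q) (m%:R) => t N d u n.
  lra.
have -> : core_const * T = 2 * M / a *
  ((M2 + (1 + E * M2) * C1 + 2 * m%:R * (M * M) + M * M * M * M2) * T).
  by rewrite [RHS]mulrA.
apply: (@le_trans _ _ (2 * M / a * B)); last first.
  by rewrite ler_wpM2l// divr_ge0 ?(ltW a0)// mulr_ge0 ?(ltW M0).
apply: (@le_trans _ _ (2 * M / a * (c * a / 2 * nz))); last first.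
  by rewrite ler_wpM2l// divr_ge0 ?(ltW a0)// mulr_ge0 ?(ltW M0).
have -> : 2 * M / a * (c * a / 2 * nz) = c * (M * nz) by field; rewrite gt_eqF.
rewrite ler_wpM2l ?(ltW c0)// -ler_pdivrMl// mulrDr.
exact: lerD.
Qed.


End TotalDerivative.


(** * Behaviour of phi and psi near 0, and growth of the augmented Lagrangian *)

Section Growth.
Context (R : realType) (X H : hilbertType R) (m : nat).
Notation Z := (X * H * 'rV[R]_m)%type.

Lemma near_within_ball (V : normedModType R) (A P : set V) (x : V) :
  (\forall y \near within A (nbhs x), P y) ->
  exists2 e : R, 0 < e & forall y, A y -> `|y - x| <= e -> P y.
Proof.
move=> /nbhs_ballP[e /= e0 eP]; exists (e / 2); first by rewrite divr_gt0.
move=> y Ay yx; apply: eP => //; rewrite -ball_normE /ball_/= distrC.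
by apply: le_lt_trans yx _; rewrite ltr_pdivrMr// ltr_pMr// ltr1n.
Qed.

Context (phi : R -> \bar R) (Dphi : R -> R -> R).
Context (phiH : phi_assumptions phi).
Context (phiD : C1_within (edom phi) (fun t => fine (phi t)) Dphi).
Context (sg0 : 0 < Dphi 0 1).
Notation sg := (Dphi 0 1).

Lemma phi0 : phi 0 = 0%E.
Proof. by apply/(phi_eq0 phiH). Qed.

Lemma edom0 : edom phi 0.
Proof. by split => //; rewrite phi0 ltry. Qed.

Lemma edom_fin t : edom phi t -> (fine (phi t))%:E = phi t.
Proof. by move=> [t0 toy]; rewrite fineK// ge0_fin_numE// phi_ge0. Qed.

Lemma phi_near0 : exists2 rho : R, 0 < rho & forall t, edom phi t -> t <= rho ->
  [/\ sg / 2 <= Dphi t 1, sg / 2 * t <= fine (phi t) & fine (phi t) <= 2 * sg * t].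
Proof.
have [Dl _ est estD] := phiD edom0.
have s2 : 0 < sg / 2 by rewrite divr_gt0.
have [r1 r10 r1P] := near_within_ball (est _ s2).
have [r2 r20 r2P] := near_within_ball (estD _ s2).
exists (Num.min r1 r2); first by rewrite lt_min r10.
move=> t tdom; rewrite le_min => /andP[tr1 tr2].
have t0 : 0 <= t by case: tdom.
have := r1P t tdom; rewrite subr0 ger0_norm// => /(_ tr1).
have := r2P t tdom; rewrite subr0 ger0_norm// => /(_ tr2 1).
rewrite phi0 /= subr0 normr1 mulr1 !ler_norml.
have -> : Dphi 0 t = t * sg by rewrite -[in LHS](mulr1 t) (islinZ Dl).
by move=> /andP[? ?] /andP[? ?]; split; nra.
Qed.

(** Convexity and phi(0) = 0 make phi(t) / t non-decreasing, so the slope bound valid near 0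
    persists on the whole domain. *)
Lemma phi_ge_linear t : edom phi t -> sg / 2 * t <= fine (phi t).
Proof.
move=> tdom; have [rho rho0 rhoP] := phi_near0.
have [trho|rhot] := leP t rho; first by case: (rhoP t tdom trho).
have t0 : 0 < t by exact: lt_trans rhot.
have rdom : edom phi rho.
  split; first exact: ltW.
  case: tdom => ? ; apply: le_lt_trans.
  by apply: phi_nondecreasing => //; exact: ltW.
have [_ h _] := rhoP rho rdom (lexx _).
have al : 0 <= rho / t <= 1.
  by rewrite divr_ge0 ?(ltW rho0) ?(ltW t0)//= ler_pdivrMr// mul1r ltW.
have := phi_convex phiH (ltW t0) (lexx 0) al.
rewrite mulr0 addr0 divfK ?gt_eqF// phi0 mule0 adde0 -(edom_fin tdom) -(edom_fin rdom).
rewrite -EFinM lee_fin => h2.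
have h3 := le_trans h h2.
have := ler_wpM2r (ltW (divr_gt0 t0 rho0)) h3.
have -> : sg / 2 * rho * (t / rho) = sg / 2 * t by field; rewrite gt_eqF.
suff -> : rho / t * fine (phi t) * (t / rho) = fine (phi t) by [].
by field; rewrite !gt_eqF.
Qed.

Context (psi : 'rV[R]_m -> R) (D : 'rV[R]_m -> 'rV[R]_m -> R).
Context (psiH : psi_assumptions psi).
Context (psiD : C1_within (@orthant R m) psi D).
Context (D0 : forall (y : 'rV[R]_m) i, orthant y -> y 0 i = 0 ->
  D y (delta_mx 0 i) = 0).

Lemma orthant0 : @orthant R m 0.
Proof. by move=> i; rewrite mxE. Qed.

Lemma Dpsi0 h : D 0 h = 0.
Proof.
have [Dl _ _ _] := psiD orthant0.
rewrite (row_sum_delta h).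
elim/big_rec: _ => [|i u _ IH]; first exact: islin0 Dl.
by rewrite (islinD Dl) (islinZ Dl) D0 ?scaler0 ?add0r ?mxE//; exact: orthant0.
Qed.

(** The derivative of psi vanishes at 0, so tolerance 1 suffices there: |psi y - psi 0| <= |y| and
    |D y h| <= |h|. *)
Lemma psi_near0 : exists2 rho : R, 0 < rho & forall y, orthant y -> `|y| <= rho ->
  psi 0 / 2 <= psi y /\ forall h, `|D y h| <= `|h|.
Proof.
have [_ _ est estD] := psiD orthant0.
have p0 := psi0_gt0 psiH.
have [r1 r10 r1P] := near_within_ball (est _ ltr01).
have [r2 r20 r2P] := near_within_ball (estD _ ltr01).
exists (Num.min (Num.min r1 r2) (psi 0 / 2)).
  by rewrite !lt_min r10 r20 divr_gt0.
move=> y yo; rewrite !le_min => /andP[/andP[yr1 yr2] yp]; split.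
  have := r1P y yo; rewrite !subr0 => /(_ yr1).
  rewrite Dpsi0 subr0 mul1r ler_norml => /andP[h _].
  by move: (`|y|) (psi y) (psi 0) h yp => ? ? ?; lra.
move=> h; have := r2P y yo; rewrite subr0 => /(_ yr2 h).
by rewrite Dpsi0 subr0 mul1r.
Qed.

Context (f : X -> R) (F : X -> H) (g : 'I_m -> X -> R).

Lemma eta_pen_ge0 x lam mu : 0 <= eta_pen f F g x lam mu.
Proof.
rewrite addr_ge0// mulr_ge0 ?exprn_ge0//.
by apply: sumr_ge0 => i _; exact: sqr_ge0.
Qed.

Lemma pfun_le x mu :
  pfun g psi x mu <= psi 0 / (1 + enorm mu ^+ 2).
Proof.
rewrite ler_wpM2r ?invr_ge0 ?(ltW (enorm1_gt0 mu))//.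
by apply: psi_max => //; exact: gpos_orthant.
Qed.

(** Holds since q_i >= g_i. Smallness of q thus puts [gpos g x] into the neighbourhood of 0 where
    psi is controlled. *)
Lemma enorm_gpos_le x mu c : enorm (gpos g x) <= enorm (qfun g psi x mu c).
Proof.
rewrite -(@ler_pXn2r _ 2) ?nnegrE ?enorm_ge0// !enormE; apply: ler_sum => i _.
rewrite !mxE; case: (leP (g i x) 0) => [_|gi]; first by rewrite expr0n sqr_ge0.
rewrite lerXn2r ?nnegrE ?le_max ?lexx//; first exact: ltW.
by rewrite (ltW gi).
Qed.

(** Below both sg / 4, available from the phi-term, and 1 / (2 psi(0)), available from the q-term.
    The summands of [growth_rem] are the costs of the two completed squares. *)
Definition growth_coef : R := Num.min (sg / 4) (psi 0)^-1 / 2.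
Definition growth_rem : R := sg^-1 + psi 0 / 2.

Lemma growth_coef_gt0 : 0 < growth_coef.
Proof. by rewrite divr_gt0// lt_min divr_gt0//= invr_gt0 (psi0_gt0 psiH). Qed.

Lemma growth_rem_gt0 : 0 < growth_rem.
Proof. by rewrite addr_gt0 ?invr_gt0// divr_gt0 ?(psi0_gt0 psiH). Qed.

(** In the factors 1 + |lambda|^2 and 1 + |mu|^2 (the latter inside 1/p), the squared multiplier
    absorbs the linear term at a cost O(1/c) and the 1 provides the growth. The estimate is
    therefore uniform in the multipliers. *)
Lemma auglagr_ge x lam mu c : 0 < c -> Omega F g phi psi x ->
  f x + c * growth_coef * (`|F x| ^+ 2 + enorm (qfun g psi x mu c) ^+ 2)
    - growth_rem / c + eta_pen f F g x lam mu <=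
  fine (auglagr f F g phi psi x lam mu c).
Proof.
move=> c0 xO; rewrite /auglagr ifT; last exact/asboolP.
have b0 := xO.1; have p0 := pfun_gt0 mu b0.
rewrite /= lerD2r -addrA -!(addrA (f x)) lerD2l.
set q := qfun g psi x mu c; set p := pfun g psi x mu in p0 *.
have psi0 := psi0_gt0 psiH.
have h1 : - (`|lam| * `|F x|) <= inner lam (F x) by apply: lerNnormlW; exact: ler_inner.
have h2 : - (enorm mu * enorm q) <= dotr mu q by apply: lerNnormlW; exact: ler_dotr.
have h3 : sg / 2 * `|F x| ^+ 2 <= fine (phi (`|F x| ^+ 2)).
  by apply: phi_ge_linear; case: xO => _ ?; split; rewrite ?exprn_ge0.
have pV : (1 + enorm mu ^+ 2) / psi 0 <= p^-1.
  rewrite -[leLHS]invrK lef_pV2 ?posrE ?invr_gt0 ?divr_gt0 ?enorm1_gt0//.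
  by rewrite invf_div; exact: pfun_le.
have h4 : c / 2 * (1 + enorm mu ^+ 2) / psi 0 * enorm q ^+ 2 <=
    c / (2 * p) * enorm q ^+ 2.
  rewrite ler_wpM2r ?exprn_ge0 ?enorm_ge0//.
  have -> : c / (2 * p) = c / 2 * p^-1 by field; rewrite gt_eqF.
  by rewrite -[leLHS]mulrA ler_wpM2l ?divr_ge0 ?(ltW c0).
have h5 : c / 2 * (1 + `|lam| ^+ 2) * (sg / 2 * `|F x| ^+ 2) <=
    c / 2 * (1 + `|lam| ^+ 2) * fine (phi (`|F x| ^+ 2)).
  rewrite ler_wpM2l// mulr_ge0 ?divr_ge0 ?(ltW c0)// addr_ge0 ?exprn_ge0//.
have k1 : c * growth_coef * `|F x| ^+ 2 <= c / 2 * (sg / 2 * `|F x| ^+ 2).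
  have -> : c / 2 * (sg / 2 * `|F x| ^+ 2) = c * (sg / 4) * `|F x| ^+ 2 by field.
  rewrite ler_wpM2r ?exprn_ge0// ler_wpM2l ?(ltW c0)// /growth_coef.
  have : 0 < Num.min (sg / 4) (psi 0)^-1 by rewrite lt_min divr_gt0//= invr_gt0.
  have : Num.min (sg / 4) (psi 0)^-1 <= sg / 4 by rewrite ge_min lexx.
  move: (Num.min _ _) => t; lra.
have k2 : c * growth_coef * enorm q ^+ 2 <= c / 2 / psi 0 * enorm q ^+ 2.
  rewrite -[c / 2 / _]mulrA ler_wpM2r ?exprn_ge0 ?enorm_ge0// ler_wpM2l ?(ltW c0)//.
  rewrite /growth_coef mulrC ler_wpM2l//.
  by rewrite ge_min lexx orbT.
(* The difference of the two sides is a perfect square over 4 c sg; likewise for mu and q below. *)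
have k3 : `|lam| * `|F x| <= c / 2 * `|lam| ^+ 2 * (sg / 2 * `|F x| ^+ 2) + sg^-1 / c.
  rewrite -subr_ge0; set t := (X in 0 <= X).
  have -> : t = (c * sg * (`|lam| * `|F x|) - 2) ^+ 2 / (4 * c * sg).
    by rewrite /t; field; rewrite !gt_eqF.
  by rewrite divr_ge0 ?sqr_ge0// !mulr_ge0 ?(ltW c0) ?(ltW sg0).
have k4 : enorm mu * enorm q <= c / 2 * enorm mu ^+ 2 / psi 0 * enorm q ^+ 2 + psi 0 / 2 / c.
  rewrite -subr_ge0; set t := (X in 0 <= X).
  have -> : t = (c * (enorm mu * enorm q) - psi 0) ^+ 2 / (2 * c * psi 0).
    by rewrite /t; field; rewrite !gt_eqF.
  by rewrite divr_ge0 ?sqr_ge0// !mulr_ge0 ?(ltW c0) ?(ltW psi0).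
rewrite /growth_rem.
move: h1 h2 h4 h5 k1 k2 k3 k4; rewrite !mulrDl !mulrDr.
lra.
Qed.

End Growth.

(** * What coercivity of Q means for the residuals and for eta *)

Section Coercivity.
Context (R : realType) (X H : hilbertType R) (m : nat).
Context (f : X -> R) (F : X -> H) (g : 'I_m -> X -> R).
Context (fd : forall y, differentiable f y).
Context (gd : forall i y, differentiable (g i) y).
Context (Fd : forall y, differentiable F y).
Context (x : X) (M : R) (M1 : 1 <= M).
Context (gM : forall i, `|g i x| <= M).
Context (f1 : forall k, `|'d f x k| <= M * `|k|).
Context (F1 : forall k, `|'d F x k| <= M * `|k|).
Context (g1 : forall i k, `|'d (g i) x k| <= M * `|k|).

Let M0 : 0 <= M. Proof. exact: le_trans ler01 M1. Qed.

Lemma QfunE l (s : 'rV[R]_m) : Qfun F g x l s =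
  2^-1 * `|'d F x (Qdir F g x l s)| ^+ 2 + 2^-1 * \sum_i
    (inner (grad (g i) x) (Qdir F g x l s) + g i x ^+ 2 * s 0 i) ^+ 2.
Proof.
rewrite /Qfun enormE; congr (_ + _ * _); apply: eq_bigr => i _.
by rewrite mul_mx_diag !mxE (mulrC (s 0 i)).
Qed.

(** DF and the gradients of the g_i are bounded, and so is one of the two factors g_i^2. A lower
    bound on Q thus passes to the simpler form that appears in [deta_dual]. *)
Lemma Qfun_le l (s : 'rV[R]_m) : Qfun F g x l s <=
  (m%:R + 1) * (M * M) *
  (`|Qdir F g x l s| ^+ 2 + \sum_i g i x ^+ 2 * s 0 i ^+ 2).
Proof.
rewrite QfunE; set w := Qdir _ _ _ _ _.
have h1 : `|'d F x w| ^+ 2 <= M * M * `|w| ^+ 2.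
  by rewrite -expr2 -exprMn lerXn2r ?nnegrE ?mulr_ge0.
have h2 : \sum_i (inner (grad (g i) x) w + g i x ^+ 2 * s 0 i) ^+ 2 <=
    2 * (m%:R * (M * M * `|w| ^+ 2) + M * M * \sum_i g i x ^+ 2 * s 0 i ^+ 2).
  rewrite (_ : m%:R * _ = \sum_(i < m) (M * M * `|w| ^+ 2)); last first.
    by rewrite sumr_const card_ord mulr_natl.
  rewrite [X in _ + X]mulr_sumr -big_split mulr_sumr; apply: ler_sum => i _ /=.
  have k1 : inner (grad (g i) x) w ^+ 2 <= M * M * `|w| ^+ 2.
    rewrite gradP// -real_normK ?num_real// -expr2 -exprMn.
    by apply: lerXn2r (g1 i w); rewrite nnegrE ?mulr_ge0.
  have k2 : (g i x ^+ 2 * s 0 i) ^+ 2 <= M * M * (g i x ^+ 2 * s 0 i ^+ 2).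
    have -> : (g i x ^+ 2 * s 0 i) ^+ 2 = g i x ^+ 2 * (g i x ^+ 2 * s 0 i ^+ 2) by ring.
    apply: ler_wpM2r; first by rewrite mulr_ge0 ?sqr_ge0.
    by rewrite -expr2 -[leLHS]real_normK ?num_real// lerXn2r ?nnegrE.
  have := sqr_ge0 (inner (grad (g i) x) w - g i x ^+ 2 * s 0 i).
  move: k1 k2; move: (inner _ _) (g i x ^+ 2 * s 0 i) (M * M * _) (M * M * _) => a b t u.
  nra.
have S0 : 0 <= \sum_i g i x ^+ 2 * s 0 i ^+ 2.
  by apply: sumr_ge0 => i _; rewrite mulr_ge0 ?sqr_ge0.
have MM0 : 0 <= M * M by rewrite mulr_ge0.
have m0 : 0 <= m%:R :> R by [].
move: S0 (sqr_ge0 `|w|) h1 h2.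
move: (\sum_i g i x ^+ 2 * _) (`|w| ^+ 2) (\sum_i _ ^+ 2) (`|_| ^+ 2) => S W S1 W1 S0 W0 h1 h2.
have := mulr_ge0 MM0 W0.
have := mulr_ge0 m0 (mulr_ge0 MM0 S0).
move: (m%:R) h2 => n; lra.
Qed.

(** The residuals are a linear map of the multipliers, whose half squared norm is Q, plus a bounded
    shift from grad f; the inequality |a + b|^2 >= |b|^2 / 2 - |a|^2 discards the shift. *)
Lemma eta_pen_ge lam (mu : 'rV[R]_m) :
  2^-1 * Qfun F g x lam mu - 2^-1 * ((1 + m%:R) * (M * M) ^+ 2) <=
  eta_pen f F g x lam mu.
Proof.
rewrite QfunE /eta_pen (grad_lagrQ fd gd Fd); set w := Qdir _ _ _ _ _.
have gfM : `|grad f x| <= M by apply: norm_grad.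
have h1 : 2^-1 * `|'d F x w| ^+ 2 - (M * M) ^+ 2 <= `|'d F x (grad f x + w)| ^+ 2.
  clearbody w; rewrite linearD.
  have a1 : `|'d F x (grad f x)| <= M * M by apply: le_trans (F1 _) _; rewrite ler_wpM2l.
  have := ler_normB ('d F x (grad f x) + 'd F x w) ('d F x (grad f x)).
  rewrite addrAC subrr add0r => a2.
  move: (normr_ge0 ('d F x w)) (normr_ge0 ('d F x (grad f x))) a1 a2.
  move: (normr_ge0 ('d F x (grad f x) + 'd F x w)).
  move: (`|_ + _|) (`|'d F x w|) (`|'d F x (grad f x)|) (M * M) => s t u v s0 t0 u0 uv tsu.
  have : t ^+ 2 <= (s + u) ^+ 2 by rewrite lerXn2r ?nnegrE ?addr_ge0.
  have : u ^+ 2 <= v ^+ 2 by rewrite lerXn2r ?nnegrE// (le_trans u0).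
  move=> h1 h2; have := sqr_ge0 (s - u); nra.
have h2 i : 2^-1 * (inner (grad (g i) x) w + g i x ^+ 2 * mu 0 i) ^+ 2 - (M * M) ^+ 2 <=
    (inner (grad (g i) x) (grad f x + w) + g i x ^+ 2 * mu 0 i) ^+ 2.
  rewrite innerDr -addrA.
  have a1 : `|inner (grad (g i) x) (grad f x)| <= M * M.
    have gi := norm_grad M0 (gd i x) (g1 i).
    exact: le_trans (ler_inner _ _) (ler_pM (normr_ge0 _) (normr_ge0 _) gi gfM).
  have : inner (grad (g i) x) (grad f x) ^+ 2 <= (M * M) ^+ 2.
    by rewrite -real_normK ?num_real// lerXn2r ?nnegrE ?mulr_ge0.
  move: (inner _ (grad f x)) (_ + _ * _) => a b.
  have := sqr_ge0 (2 * a + b); nra.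
have h3 : 2^-1 * (\sum_i (inner (grad (g i) x) w + g i x ^+ 2 * mu 0 i) ^+ 2) -
    m%:R * (M * M) ^+ 2 <=
    \sum_i (inner (grad (g i) x) (grad f x + w) + g i x ^+ 2 * mu 0 i) ^+ 2.
  have -> : m%:R * (M * M) ^+ 2 = \sum_(i < m) (M * M) ^+ 2.
    by rewrite sumr_const card_ord mulr_natl.
  by rewrite mulr_sumr -sumrB; apply: ler_sum => i _; exact: h2.
move: h1 h3; move: (\sum_i _) (\sum_i _) => S1 S2.
move: (`|_| ^+ 2) (`|_| ^+ 2) ((M * M) ^+ 2) (m%:R) => W1 W2 t n; lra.
Qed.

End Coercivity.

(** * Uniform constants from the boundedness assumptions *)

Section Bounds.
Context (R : realType) (X : hilbertType R).

Lemma bounded_C2P (W : normedModType R) (h : X -> W) (V : set X) :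
  bounded_C2 V h -> exists2 C : R, 0 < C & forall x, V x ->
    [/\ `|h x| <= C, forall k, `|'d h x k| <= C * `|k| &
        forall k l, `|diff2 h x k l| <= C * `|k| * `|l|].
Proof.
move=> [[M [_ MP]] [C1 C1P] [C2 C2P]].
exists (`|M| + 1 + `|C1| + `|C2|); first by rewrite 2?ltr_wpDr// ltr_wpDl.
move=> x Vx; split=> [|k|k l].
- have MN : M < `|M| + 1 by rewrite (le_lt_trans (ler_norm M))// ltrDl.
  have hM : `|h x| <= `|M| + 1 by exact: (MP _ MN x Vx).
  apply: le_trans hM _; rewrite -addrA lerDl addr_ge0//.
- apply: le_trans (C1P x Vx k) _; rewrite ler_wpM2r//.
  by apply: le_trans (ler_norm C1) _; rewrite -addrA addrCA lerDl !addr_ge0.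
- apply: le_trans (C2P x Vx k l) _; rewrite ler_wpM2r// ler_wpM2r//.
  by apply: le_trans (ler_norm C2) _; rewrite addrC lerDl !addr_ge0.
Qed.

Lemma bounded_C2_familyP (m : nat) (W : normedModType R) (h : 'I_m -> X -> W) (V : set X) :
  (forall i, bounded_C2 V (h i)) -> exists2 C : R, 0 < C & forall i x, V x ->
    [/\ `|h i x| <= C, forall k, `|'d (h i) x k| <= C * `|k| &
        forall k l, `|diff2 (h i) x k l| <= C * `|k| * `|l|].
Proof.
move=> hb; have /choice[C CP] : forall i, exists C : R, 0 < C /\ forall x, V x ->
    [/\ `|h i x| <= C, forall k, `|'d (h i) x k| <= C * `|k| &
        forall k l, `|diff2 (h i) x k l| <= C * `|k| * `|l|].
  by move=> i; have [C C0 CP] := bounded_C2P (hb i); exists C.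
have Cs : 0 <= \sum_i C i by apply: sumr_ge0 => i _; case: (CP i) => /ltW.
exists (1 + \sum_i C i); first by rewrite ltr_pwDl.
move=> i x Vx; have [C0 /(_ x Vx)[h0 h1 h2]] := CP i.
have CC : C i <= 1 + \sum_i C i.
  rewrite (bigD1 i)//= addrCA lerDl addr_ge0//.
  by apply: sumr_ge0 => j _; case: (CP j) => /ltW.
split=> [|k|k l]; first exact: le_trans h0 CC.
  by apply: le_trans (h1 k) _; rewrite ler_wpM2r.
by apply: le_trans (h2 k l) _; rewrite ler_wpM2r// ler_wpM2r.
Qed.

End Bounds.

(** * Choice of the penalty threshold *)

Section LowerBound.
Context (R : realType) (X H : hilbertType R) (m : nat).
Context (f : X -> R) (F : X -> H) (g : 'I_m -> X -> R).
Context (fd : forall y, differentiable f y).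
Context (gd : forall i y, differentiable (g i) y).
Context (Fd : forall y, differentiable F y).
Context (psi : 'rV[R]_m -> R) (D : 'rV[R]_m -> 'rV[R]_m -> R).
Context (psiH : psi_assumptions psi).
Context (psiD : C1_within (@orthant R m) psi D).
Context (D0 : forall (y : 'rV[R]_m) i, orthant y -> y 0 i = 0 ->
  D y (delta_mx 0 i) = 0).
Context (phi : R -> \bar R) (Dphi : R -> R -> R).
Context (phiH : phi_assumptions phi).
Context (phiD : C1_within (edom phi) (fun t => fine (phi t)) Dphi).
Context (sg0 : 0 < Dphi 0 1).
Notation Om := (Omega F g phi psi).
Context (fC2 : forall x, Om x -> is_diff2 f x (diff2 f x)).
Context (FC2 : forall x, Om x -> is_diff2 F x (diff2 F x)).
Context (gC2 : forall x, Om x -> forall i, is_diff2 (g i) x (diff2 (g i) x)).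
Notation sg := (Dphi 0 1).
Notation kap := (growth_coef Dphi psi).
Notation rem := (growth_rem Dphi psi).

Lemma common_bound (s : seq R) : exists2 M, 1 <= M & forall x, x \in s -> x <= M.
Proof.
elim: s => [|y s [M M1 MP]]; first by exists 1.
exists (Num.max y M) => [|x]; first by rewrite le_max M1 orbT.
by rewrite inE le_max => /predU1P[->|/MP ->]; rewrite ?lexx ?orbT.
Qed.

Lemma norm_db_le x (C : R) : (forall h, `|D (gpos g x) h| <= `|h|) ->
  (forall i k, `|'d (g i) x k| <= C * `|k|) ->
  forall k, `|db g D x k| <= m%:R * C * `|k|.
Proof.
move=> D1 g1 k; apply: le_trans (ler_norm_sum _ _ _) _.
apply: (@le_trans _ _ (\sum_(i < m) (C * `|k|))); last first.
  by rewrite sumr_const card_ord -[leLHS]mulr_natl mulrA.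
apply: ler_sum => i _; rewrite normrM -[leRHS]mul1r; apply: ler_pM => //.
apply: le_trans (D1 _) _; apply: le_trans (norm_le_sum _) _.
rewrite (bigD1 i)//= mxE !eqxx normr1 big1 ?addr0// => j ji.
by rewrite mxE (negbTE ji) andbF normr0.
Qed.

Lemma sublevel_Omega c gam x lam mu :
  sublevel f F g phi psi c gam (x, lam, mu) -> Om x.
Proof.
rewrite /sublevel /= /auglagr; case: ifPn => [/asboolP//|_].
by rewrite leye_eq.
Qed.

Lemma sublevel_ge c gam x lam mu : 0 < c ->
  sublevel f F g phi psi c gam (x, lam, mu) ->
  f x + c * kap * (`|F x| ^+ 2 + enorm (qfun g psi x mu c) ^+ 2) - rem / c
    + eta_pen f F g x lam mu <= gam.
Proof.
move=> c0 sl; have xO := sublevel_Omega sl.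
apply: le_trans (auglagr_ge phiH phiD sg0 psiH f lam mu c0 xO) _.
move: sl; rewrite /sublevel /= /auglagr ifT; last exact/asboolP.
by rewrite lee_fin.
Qed.

(** The multipliers are restricted by a number B, which serves both a given bounded set and the
    bound that a sublevel set imposes by itself. *)
Lemma local_lower_bound (V : set X) :
  V `<=` Om -> Q_coercive_on F g V -> data_bounded_on f F g V ->
  forall K gam B : R, 0 < K -> exists2 cstar : R, 0 < cstar &
    forall c : R, cstar <= c -> forall x lam (mu : 'rV[R]_m),
      V x -> `|lam| <= B -> enorm mu <= B ->
      sublevel f F g phi psi c gam (x, lam, mu) ->
      grad_lower_bound f F g phi psi K c (x, lam, mu).
Proof.
move=> VO [a a0 aP] [/bounded_C2P[Cf Cf0 CfP] /bounded_C2_familyP[Cg Cg0 CgP]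
  /bounded_C2P[CF CF0 CFP]] K gam B K0.
have [r1 r10 r1P] := phi_near0 phiH phiD sg0.
have [r2 r20 r2P] := psi_near0 psiH psiD D0.
have psi0 := psi0_gt0 psiH.
have k0 : 0 < kap := growth_coef_gt0 sg0 psiH.
have rem0 : 0 < rem := growth_rem_gt0 sg0 psiH.
(* Beyond the data bounds: 2 (1 + B^2) / psi(0) gives p >= 1/M and psi(0) gives p <= M; 2 / sg gives
   phi' >= 1/M and 2 sg gives phi(t) <= M t; m Cg bounds the derivative of b. *)
have [M M1 MP] := common_bound [:: Cf; Cg; CF; B; 2 * (1 + B ^+ 2) / psi 0;
  psi 0; 2 / sg; 2 * sg; m%:R * Cg].
have [MCf MCg MCF MB Mb] : [/\ Cf <= M, Cg <= M, CF <= M, B <= M &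
  2 * (1 + B ^+ 2) / psi 0 <= M] by split; apply: MP; rewrite !inE eqxx ?orbT.
have [Mpsi Ms Ms' MmC] : [/\ psi 0 <= M, 2 / sg <= M, 2 * sg <= M &
  m%:R * Cg <= M] by split; apply: MP; rewrite !inE eqxx ?orbT.
have M0 : 0 < M by exact: lt_le_trans ltr01 M1.
set m1 : R := m%:R + 1.
have m10 : 0 < m1 by rewrite ltr_wpDl.
pose a1 := a / (m1 * (M * M)).
have a10 : 0 < a1 by rewrite divr_gt0// !mulr_gt0.
have [C C0 CP] : exists2 C : R, 0 < C & core_const m a1 M <= C.
  have [C C1 CP] := common_bound [:: core_const m a1 M].
  by exists C; [exact: lt_le_trans ltr01 C1|apply: CP; rewrite inE].
have [Gam Gam0 GamP] : exists2 Gam : R, 0 < Gam & gam + Cf + rem <= Gam.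
  have [Gam G1 GP] := common_bound [:: gam + Cf + rem].
  by exists Gam; [exact: lt_le_trans ltr01 G1|apply: GP; rewrite inE].
have Gk0 : 0 < Gam / kap by rewrite divr_gt0.
(* If c >= (Gam / kap) t, then (|F|^2 + |q|^2) t <= 1. The value t1 gives |F|^2 <= r1, t2 gives |q|
   <= r2, 1 gives |q| <= 1, and t3 gives 4 C |F| <= 1 and 4 C |q| <= 1. *)
pose t1 := r1^-1; pose t2 := (r2 ^+ 2)^-1; pose t3 := (4 * C) ^+ 2.
have t10 : 0 < t1 by rewrite invr_gt0.
have t20 : 0 < t2 by rewrite invr_gt0 exprn_gt0.
have t30 : 0 < t3 by rewrite exprn_gt0// mulr_gt0.
have t1r : t1 * r1 = 1 by rewrite mulVf// gt_eqF.
have t2r : t2 * r2 ^+ 2 = 1 by rewrite mulVf// gt_eqF ?exprn_gt0.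
have t3r : t3 = (4 * C) ^+ 2 by [].
clearbody t1 t2 t3.
(* The term 4 C absorbs the linear part |F| + |q| of T; 2 C K leaves the factor K in the final
   inequality. *)
exists (1 + Gam / kap * (t1 + t2 + 1 + t3) + 4 * C + 2 * C * K).
  have ts0 : 0 < t1 + t2 + 1 + t3 by rewrite !addr_gt0.
  by rewrite !addr_gt0 ?(mulr_gt0 Gk0 ts0)// !mulr_gt0.
move=> c cC x lam mu Vx lamB muB sl.
have [Gt1 Gt2 Gt3] : [/\ 0 < Gam / kap * t1, 0 < Gam / kap * t2 & 0 < Gam / kap * t3].
  by split; exact: mulr_gt0.
have CK0 : 0 < C * K by exact: mulr_gt0.
have [c1 cC4 cCK] : [/\ 1 <= c, 4 * C <= c & 2 * (C * K) <= c].
  by split; apply: le_trans cC; rewrite !mulrDr; lra.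
have [ct1 ct2 ct3 ct4] : [/\ Gam / kap * t1 <= c, Gam / kap * t2 <= c,
    Gam / kap * 1 <= c & Gam / kap * t3 <= c].
  by split; apply: le_trans cC; rewrite !mulrDr; lra.
have c0 : 0 < c by exact: lt_le_trans ltr01 c1.
have xO := VO x Vx.
set q := qfun g psi x mu c.
set S2 := `|F x| ^+ 2 + enorm q ^+ 2.
have S20 : 0 <= S2 by rewrite addr_ge0 ?exprn_ge0 ?enorm_ge0.
have S2G : c * kap * S2 <= Gam.
  have := sublevel_ge c0 sl; have := eta_pen_ge0 f F g x lam mu.
  have [fx _ _] := CfP x Vx.
  have : rem / c <= rem by rewrite ler_pdivrMr// ler_peMr// ltW.
  move: fx; rewrite ler_norml => /andP[fx _]; move: GamP.
  rewrite -/q -/S2; lra.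
have key t : 0 < t -> Gam / kap * t <= c -> S2 * t <= 1.
  move=> tpos tc; rewrite -(ler_pM2l (mulr_gt0 c0 k0)) mulr1 mulrA.
  apply: le_trans (ler_wpM2r (ltW tpos) S2G) _.
  by rewrite -ler_pdivrMr// mulrAC.
have Fr1 : `|F x| ^+ 2 <= r1.
  have := key _ t10 ct1; rewrite -t1r [leRHS]mulrC ler_pM2r//; apply: le_trans.
  by rewrite lerDl exprn_ge0// enorm_ge0.
have qr2 : enorm q <= r2.
  have := key _ t20 ct2; rewrite -t2r [leRHS]mulrC ler_pM2r// => h.
  rewrite -(@ler_pXn2r _ 2) ?nnegrE ?enorm_ge0 ?(ltW r20)//; apply: le_trans h.
  by rewrite lerDr exprn_ge0.
have q1 : enorm q <= 1.
  have := key _ ltr01 ct3; rewrite mulr1 => h.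
  rewrite -(@ler_pXn2r _ 2) ?nnegrE ?enorm_ge0// expr1n; apply: le_trans h.
  by rewrite lerDr exprn_ge0.
have C40 : 0 < 4 * C by rewrite mulr_gt0.
have F4 : 4 * C * `|F x| <= 1.
  rewrite -(@ler_pXn2r _ 2) ?nnegrE ?mulr_ge0 ?(ltW C0)// expr1n exprMn -t3r mulrC.
  apply: le_trans (key _ t30 ct4); rewrite ler_wpM2r ?(ltW t30)//.
  by rewrite lerDl exprn_ge0// enorm_ge0.
have q4 : 4 * C * enorm q <= 1.
  rewrite -(@ler_pXn2r _ 2) ?nnegrE ?mulr_ge0 ?enorm_ge0 ?(ltW C0)// expr1n exprMn -t3r mulrC.
  apply: le_trans (key _ t30 ct4); rewrite ler_wpM2r ?(ltW t30)//.
  by rewrite lerDr exprn_ge0.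
have gr2 : `|gpos g x| <= r2.
  apply: le_trans qr2; apply: le_trans (enorm_gpos_le _ _ _ _ _).
  exact: norm_le_enorm.
have [psi2 DP] := r2P _ (gpos_orthant g x) gr2.
have xdom : edom phi (`|F x| ^+ 2) by case: xO => _ ?; split; rewrite ?exprn_ge0.
have [phi1 phi2 phi3] := r1P _ xdom Fr1.
have [_ f1 f2] := CfP x Vx; have [_ F1 F2] := CFP x Vx.
have g1 i k : `|'d (g i) x k| <= Cg * `|k| by case: (CgP i x Vx).
have g1' i k : `|'d (g i) x k| <= M * `|k|.
  by apply: le_trans (g1 i k) _; rewrite ler_wpM2r.
have mu0 := enorm_ge0 mu.
have gM i : `|g i x| <= M by have [h _ _] := CgP i x Vx; exact: le_trans h MCg.
have F1' k : `|'d F x k| <= M * `|k| by apply: le_trans (F1 k) _; rewrite ler_wpM2r.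
have coer l (s : 'rV[R]_m) : a1 * (`|l| ^+ 2 + enorm s ^+ 2) <=
    `|Qdir F g x l s| ^+ 2 + \sum_i g i x ^+ 2 * s 0 i ^+ 2.
  have h := le_trans (aP x Vx l s) (Qfun_le gd M1 gM F1' g1' l s).
  rewrite /a1 mulrAC ler_pdivrMr ?mulr_gt0//.
  by rewrite [leRHS]mulrC.
have := @core_ineq R X H m f F g fd gd Fd psi D psiD D0 phi Dphi phiH phiD
  x lam mu c (diff2 f x) (diff2 F x) (fun i => diff2 (g i) x)
  (fC2 xO) (FC2 xO) (gC2 xO) xO c0 a1 M a10 M1 coer.
move=> core0.
have pV : M^-1 <= pfun g psi x mu.
  have hp : psi 0 / 2 / (1 + B ^+ 2) <= pfun g psi x mu.
    apply: ler_pM => //; rewrite ?invr_ge0 ?addr_ge0 ?sqr_ge0 ?divr_ge0 ?(ltW psi0)//.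
    rewrite lef_pV2 ?posrE ?enorm1_gt0 ?ltr_pwDl ?sqr_ge0//.
    by rewrite lerD2l lerXn2r ?nnegrE// (le_trans mu0).
  apply: le_trans hp; rewrite -[leRHS]invrK lef_pV2 ?posrE//; last first.
    by rewrite invr_gt0 !divr_gt0// ltr_pwDl ?sqr_ge0.
  by apply: le_trans Mb; rewrite !invfM !invrK; lra.
have pM : pfun g psi x mu <= M.
  apply: le_trans (pfun_le psiH g x mu) _; apply: le_trans Mpsi.
  by rewrite ler_pdivrMr ?enorm1_gt0// ler_peMr ?(ltW psi0)// lerDl exprn_ge0.
have phi'M : M^-1 <= Dphi (`|F x| ^+ 2) 1.
  apply: le_trans phi1; rewrite -[leRHS]invrK lef_pV2 ?posrE ?invr_gt0 ?divr_gt0//.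
  by rewrite invf_div.
have phiM : phiF F phi x <= M * `|F x| ^+ 2.
  by apply: le_trans phi3 _; rewrite ler_wpM2r ?exprn_ge0.
have phiF0 : 0 <= phiF F phi x.
  by rewrite fine_ge0// phi_ge0// exprn_ge0.
have dbM k : `|db g D x k| <= M * `|k|.
  by apply: le_trans (norm_db_le DP g1 k) _; rewrite ler_wpM2r.
have f1' k : `|'d f x k| <= M * `|k| by apply: le_trans (f1 k) _; rewrite ler_wpM2r.
have f2' k l : `|diff2 f x k l| <= M * `|k| * `|l|.
  by apply: le_trans (f2 k l) _; rewrite ler_wpM2r// ler_wpM2r.
have F2' k l : `|diff2 F x k l| <= M * `|k| * `|l|.
  by apply: le_trans (F2 k l) _; rewrite ler_wpM2r// ler_wpM2r.
have g2' i k l : `|diff2 (g i) x k l| <= M * `|k| * `|l|.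
  have [_ _ g2] := CgP i x Vx.
  by apply: le_trans (g2 k l) _; rewrite ler_wpM2r// ler_wpM2r.
have {core0} := core0 (le_trans lamB MB) (le_trans muB MB) gM f1' F1' g1' f2' F2' g2'
  pV pM phi'M phiF0 phiM (le_trans q1 M1) dbM.
rewrite /grad_lower_bound /= -/q -/S2.
have d0 := delta_ge0 f F g psi phi x lam mu c.
move: d0; set d := norm_grad_auglagr _ _ _ _ _ _ _ => d0 core1.
have F0 := normr_ge0 (F x); have q0 := enorm_ge0 q.
have T0 : 0 <= d + `|F x| + enorm q + c * S2.
  by rewrite !addr_ge0// mulr_ge0// ltW.
have core2 := le_trans core1 (ler_wpM2r T0 CP).
have kF : 4 * C * (c * `|F x| ^+ 2) <= c * `|F x|.
  have := ler_wpM2r (mulr_ge0 (ltW c0) F0) F4.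
  by move: (`|F x|) => t; lra.
have kq : 4 * C * (c * enorm q ^+ 2) <= c * enorm q.
  have := ler_wpM2r (mulr_ge0 (ltW c0) q0) q4.
  by move: (enorm q) => t; lra.
have FC := ler_wpM2r (addr_ge0 F0 q0) cC4.
have FK := ler_wpM2r (addr_ge0 F0 q0) cCK.
rewrite -(ler_pM2l C0).
(* The linear and the quadratic part of C T take a quarter of c (|F| + |q|) each; the remaining half
   is at most C d and at least C K (|F| + |q|). *)
move: core2 kF kq FC FK; rewrite /S2; clearbody d; clear core1 T0.
move: d d0 (`|F x|) (enorm q) => d _ t u; lra.
Qed.

(** Reduction to [local_lower_bound]: for large c the sublevel set itself forces x into V and bounds
    the multipliers. *)
Lemma sublevel_lower_bound r eps gam : 0 < r -> 0 < eps ->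
  let V := Omega_lev f F g phi psi r (gam + eps) in
  Q_coercive_on F g V -> data_bounded_on f F g V ->
  forall K : R, 0 < K -> exists2 cstar : R, 0 < cstar &
    forall c : R, cstar <= c -> forall x lam (mu : 'rV[R]_m),
      sublevel f F g phi psi c gam (x, lam, mu) ->
      grad_lower_bound f F g phi psi K c (x, lam, mu).
Proof.
move=> r0 eps0 V Vcoer Vb K K0.
have VO : V `<=` Om by move=> x [].
have k0 : 0 < kap := growth_coef_gt0 sg0 psiH.
have rem0 : 0 < rem := growth_rem_gt0 sg0 psiH.
(* Once c kap >= r the growth term dominates r (|F|^2 + |gpos|^2), and [eps] pays for [rem / c]. *)
have inV c x lam mu : 0 < c -> r / kap <= c -> rem / eps <= c ->
    sublevel f F g phi psi c gam (x, lam, mu) -> V x.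
  move=> c0 rc epsc sl; split; first exact: sublevel_Omega sl.
  have := sublevel_ge c0 sl; have := eta_pen_ge0 f F g x lam mu.
  have rk : r <= c * kap by rewrite -ler_pdivrMr.
  have rce : rem / c <= eps by rewrite ler_pdivrMr// mulrC -ler_pdivrMr.
  have gq := enorm_gpos_le psi g x mu c.
  have : enorm (gpos g x) ^+ 2 <= enorm (qfun g psi x mu c) ^+ 2.
    by rewrite lerXn2r ?nnegrE ?enorm_ge0.
  move: (enorm_ge0 (gpos g x)) (normr_ge0 (F x)) rce => g0 F0.
  move: (rem / c) (eta_pen _ _ _ _ _ _) (enorm (qfun _ _ _ _ _) ^+ 2) => t e Q2.
  have F20 : 0 <= `|F x| ^+ 2 by rewrite exprn_ge0.
  have g20 : 0 <= enorm (gpos g x) ^+ 2 by rewrite exprn_ge0.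
  move: (`|F x| ^+ 2) (enorm (gpos g x) ^+ 2) F20 g20 => F2 g2 F20 g20 te gQ e0 h.
  have FQ0 : 0 <= F2 + Q2 by rewrite addr_ge0// (le_trans g20).
  have h1 := ler_wpM2r FQ0 rk.
  have h2 := ler_wpM2l (ltW r0) gQ.
  lra.
have [a a0 aP] := Vcoer.
have [fb gb Fb] := Vb.
have [Cf Cf0 CfP] := bounded_C2P fb; have [Cg Cg0 CgP] := bounded_C2_familyP gb.
have [CF CF0 CFP] := bounded_C2P Fb.
have [M M1 MP] := common_bound [:: Cf; Cg; CF].
have [MCf MCg MCF] : [/\ Cf <= M, Cg <= M & CF <= M].
  by split; apply: MP; rewrite !inE eqxx ?orbT.
(* On the sublevel set eta <= gam + Cf + rem, so [eta_pen_ge] and coercivity give a (|lam|^2 +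
   |mu|^2) <= Q <= 2 E. *)
set E := gam + Cf + rem + 2^-1 * ((1 + m%:R) * (M * M) ^+ 2).
have [B B1 BP] := common_bound [:: 2 * E / a].
have {BP} BE : 2 * E / a <= B by apply: BP; rewrite inE.
have lammu c x lam (mu : 'rV[R]_m) : 1 <= c -> V x ->
    sublevel f F g phi psi c gam (x, lam, mu) -> `|lam| <= B /\ enorm mu <= B.
  move=> c1 Vx sl; have c0 : 0 < c by exact: lt_le_trans ltr01 c1.
  have [fx f1 _] := CfP x Vx; have [_ F1 _] := CFP x Vx.
  have M0 : 0 <= M by exact: le_trans ler01 M1.
  have gx i k : `|'d (g i) x k| <= M * `|k|.
    by have [_ h _] := CgP i x Vx; apply: le_trans (h k) _; rewrite ler_wpM2r.
  have f1' k : `|'d f x k| <= M * `|k|.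
    by apply: le_trans (f1 k) _; rewrite ler_wpM2r.
  have F1' k : `|'d F x k| <= M * `|k|.
    by apply: le_trans (F1 k) _; rewrite ler_wpM2r.
  have h1 := eta_pen_ge fd gd Fd M1 f1' F1' gx lam mu.
  have h2 := sublevel_ge c0 sl.
  have h3 := aP x Vx lam mu.
  have h4 : rem / c <= rem by rewrite ler_pdivrMr// ler_peMr// ltW.
  have h5 : 0 <= c * kap * (`|F x| ^+ 2 + enorm (qfun g psi x mu c) ^+ 2).
    apply: mulr_ge0; first by apply: mulr_ge0; exact: ltW.
    by rewrite addr_ge0 ?exprn_ge0 ?enorm_ge0.
  have h6 : - Cf <= f x by move: fx; rewrite ler_norml => /andP[].
  have h7 : a * (`|lam| ^+ 2 + enorm mu ^+ 2) <= 2 * E.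
    move: h1 h2 h3 h4 h5 h6; rewrite /E.
    move: (c * kap * _) (rem / c) (eta_pen _ _ _ _ _ _) (Qfun _ _ _ _ _) => t1 t2 t3 t4.
    move: ((1 + m%:R) * _) (a * _) => t5 t6; lra.
  have h8 : `|lam| ^+ 2 + enorm mu ^+ 2 <= B.
    by apply: le_trans BE; rewrite ler_pdivlMr// mulrC.
  have B0 : 0 <= B by exact: le_trans ler01 B1.
  have BB : B <= B ^+ 2 by rewrite expr2 ler_peMl.
  split; rewrite -(@ler_pXn2r _ 2) ?nnegrE ?enorm_ge0//; apply: le_trans BB;
    apply: le_trans h8.
    by rewrite lerDl exprn_ge0// enorm_ge0.
  by rewrite lerDr exprn_ge0.
have [c1 c10 c1P] := local_lower_bound VO Vcoer Vb gam B K0.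
have [cs cs1 csP] := common_bound [:: c1; r / kap; rem / eps].
exists cs; first exact: lt_le_trans ltr01 cs1.
move=> c csc x lam mu sl.
have [cc1 cr ce] : [/\ c1 <= c, r / kap <= c & rem / eps <= c].
  by split; apply: le_trans csc; apply: csP; rewrite !inE eqxx ?orbT.
have c1' : 1 <= c by exact: le_trans csc.
have Vx : V x by apply: inV sl => //; exact: lt_le_trans ltr01 c1'.
have [lamB muB] := lammu c x lam mu c1' Vx sl.
exact: c1P Vx lamB muB sl.
Qed.

End LowerBound.

Theorem theorem4p1 (R : realType) (X H : hilbertType R) (m : nat)
    (f : X -> R) (F : X -> H) (g : 'I_m -> X -> R)
    (phi : R -> \bar R) (psi : 'rV[R]_m -> R) :
  C1_on setT f -> (forall i, C1_on setT (g i)) -> C1_on setT F ->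
  has_global_solution f F g ->
  phi_assumptions phi -> psi_assumptions psi ->
  C2_on (Omega F g phi psi) f ->
  (forall i, C2_on (Omega F g phi psi) (g i)) ->
  C2_on (Omega F g phi psi) F ->
  phi_C1 phi ->
  (forall V : set X,
     V `<=` Omega F g phi psi -> bounded_set V ->
     Q_coercive_on F g V -> data_bounded_on f F g V ->
     forall (K gamma : R) (Lambda : set (H * 'rV[R]_m)),
     0 < K -> bounded_set Lambda ->
     exists2 cstar : R, 0 < cstar & forall c : R, cstar <= c ->
       forall (x : X) (lam : H) (mu : 'rV[R]_m),
       V x -> Lambda (lam, mu) ->
       sublevel f F g phi psi c gamma (x, lam, mu) ->
       grad_lower_bound f F g phi psi K c (x, lam, mu))
  /\
  (forall r eps gamma : R, 0 < r -> 0 < eps ->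
     bounded_set (Omega_lev f F g phi psi r (gamma + eps)) ->
     Q_coercive_on F g (Omega_lev f F g phi psi r (gamma + eps)) ->
     data_bounded_on f F g (Omega_lev f F g phi psi r (gamma + eps)) ->
     forall K : R, 0 < K ->
     exists2 cstar : R, 0 < cstar & forall c : R, cstar <= c ->
       forall (x : X) (lam : H) (mu : 'rV[R]_m),
       sublevel f F g phi psi c gamma (x, lam, mu) ->
       grad_lower_bound f F g phi psi K c (x, lam, mu)).
Proof.
move=> fC1 gC1 FC1 _ phiH psiH fC2 gC2 FC2 [Dphi [phiD sg0]].
have [D [psiD D0]] := psi_C1 psiH.
have fd y : differentiable f y by case: (fC1 y I).
have gd i y : differentiable (g i) y by case: (gC1 i y I).
have Fd y : differentiable F y by case: (FC1 y I).
have f2 x : Omega F g phi psi x -> is_diff2 f x (diff2 f x).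
  by move=> xO; case: fC2 => _ /(_ x xO)[].
have F2 x : Omega F g phi psi x -> is_diff2 F x (diff2 F x).
  by move=> xO; case: FC2 => _ /(_ x xO)[].
have g2 x : Omega F g phi psi x -> forall i, is_diff2 (g i) x (diff2 (g i) x).
  by move=> xO i; case: (gC2 i) => _ /(_ x xO)[].
split=> [V VO _ Vcoer Vb K gam Lam K0 [N [_ LamN]]|r eps gam r0 eps0 _ Vcoer Vb K K0].
  (* The factor 1 + m covers both lam and the passage from the maximum norm of mu to its Euclidean
     norm. *)
  pose B := (`|N| + 1) * (1 + m%:R).
  have [cs cs0 csP] := local_lower_bound fd gd Fd psiH psiD D0 phiH phiD sg0
    f2 F2 g2 VO Vcoer Vb gam B K0.
  exists cs => // c cc x lam mu Vx Lx sl.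
  (* Boundedness of [Lam] provides bounds strictly above N only, hence the shift by 1. *)
  have NN : N < `|N| + 1 by rewrite (le_lt_trans (ler_norm N))// ltrDl.
  have : `|(lam, mu)| <= `|N| + 1 by exact: (LamN _ NN _ Lx).
  rewrite prod_normE /= ge_max => /andP[lamN muN].
  have N0 : 0 <= `|N| + 1 by rewrite addr_ge0.
  apply: csP sl => //.
    by apply: le_trans lamN _; rewrite /B mulrDr mulr1 lerDl mulr_ge0.
  apply: le_trans (enorm_le_norm _) _.
  apply: (@le_trans _ _ (m%:R * (`|N| + 1))); first exact: ler_wpM2l.
  by rewrite /B [leRHS]mulrDr mulr1 [leLHS]mulrC lerDr.
exact: (sublevel_lower_bound fd gd Fd psiH psiD D0 phiH phiD sg0 f2 F2 g2
  r0 eps0 Vcoer Vb K0).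
Qed.
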